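(* Let $B$ be a left or right coideal subalgebra of $S$. Then $S$ is a free left $B$-module (and, consequently, a free right $B$-module).
   Context: Let $\mathcal H$ be a finite-dimensional Hilbert space and $V$ a multiplicative unitary on $\mathcal H$ ($V_{12}V_{13}V_{23}=V_{23}V_{12}$) of multiplicity 1 (one-dimensional space of vectors $\xi$ with $V(\xi\otimes\eta)=\xi\otimes\eta$ for all $\eta$). $S=\{(\omega\otimes\mathrm{id})(V):\omega\in\mathcal L(\mathcal H)^*\}$ with coproduct $\delta(x)=V(x\otimes1)V^*$. A left (resp. right) coideal subalgebra of $S$ is a subalgebra $B\subset S$ containing $1$ with $\delta(B)\subset S\otimes B$ (resp. $\delta(B)\subset B\otimes S$). *)

(* Defs.v *)
(* Finite-dimensional Hilbert space H = C^n with
   C = R[i] (complex numbers over a real field R : realType);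
   operators on H are 'M[C]_n, operators on H (x) H are 'M[C]_(n * n)
   (index of e_i (x) e_j is mxvec_index i j), operators on H (x) H (x) H
   are 'M[C]_(n * n * n) (index of e_i (x) e_j (x) e_k is
   mxvec_index (mxvec_index i j) k). *)
From mathcomp Require Import all_boot all_algebra.
From mathcomp Require Import complex reals.
Set Implicit Arguments.
Unset Strict Implicit.
Unset Printing Implicit Defensive.
Import GRing.Theory Num.Theory.
Local Open Scope ring_scope.

(* inverse of mxvec_index *)
Definition unpair (m n : nat) (p : 'I_(m * n)) : 'I_m * 'I_n :=
  enum_val (cast_ord (esym (mxvec_cast m n)) p).

Section Ops.
Variable C : numClosedFieldType.
Variable n : nat.

Definition adjmx (m : nat) (A : 'M[C]_m) : 'M[C]_m :=
  map_mx Num.conj_op A^T.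

Definition unitary (m : nat) (A : 'M[C]_m) : Prop :=
  A *m adjmx A = 1%:M /\ adjmx A *m A = 1%:M.

Definition tensop (A B : 'M[C]_n) : 'M[C]_(n * n) :=
  \matrix_(p, q) (A (unpair p).1 (unpair q).1 * B (unpair p).2 (unpair q).2).

Definition tensvec (x y : 'cV[C]_n) : 'cV[C]_(n * n) :=
  \col_p (x (unpair p).1 0 * y (unpair p).2 0).

Definition ix1 (p : 'I_(n * n * n)) : 'I_n := (unpair (unpair p).1).1.
Definition ix2 (p : 'I_(n * n * n)) : 'I_n := (unpair (unpair p).1).2.
Definition ix3 (p : 'I_(n * n * n)) : 'I_n := (unpair p).2.

Definition leg12 (V : 'M[C]_(n * n)) : 'M[C]_(n * n * n) :=
  \matrix_(p, q) (V (mxvec_index (ix1 p) (ix2 p)) (mxvec_index (ix1 q) (ix2 q))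
                  * (ix3 p == ix3 q)%:R).
Definition leg13 (V : 'M[C]_(n * n)) : 'M[C]_(n * n * n) :=
  \matrix_(p, q) (V (mxvec_index (ix1 p) (ix3 p)) (mxvec_index (ix1 q) (ix3 q))
                  * (ix2 p == ix2 q)%:R).
Definition leg23 (V : 'M[C]_(n * n)) : 'M[C]_(n * n * n) :=
  \matrix_(p, q) (V (mxvec_index (ix2 p) (ix3 p)) (mxvec_index (ix2 q) (ix3 q))
                  * (ix1 p == ix1 q)%:R).

Definition multiplicative_unitary (V : 'M[C]_(n * n)) : Prop :=
  unitary V /\ leg12 V *m leg13 V *m leg23 V = leg23 V *m leg12 V.

Definition fixed_vector (V : 'M[C]_(n * n)) (xi : 'cV[C]_n) : Prop :=
  forall eta : 'cV[C]_n, V *m tensvec xi eta = tensvec xi eta.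

Definition multiplicity_one (V : 'M[C]_(n * n)) : Prop :=
  exists2 xi0 : 'cV[C]_n, xi0 != 0 /\ fixed_vector V xi0 &
    forall xi, fixed_vector V xi -> exists c : C, xi = c *: xi0.

(* slice map (omega (x) id)(V), where the linear functional omega on
   L(H) = 'M_n is given by its values w i k = omega(e_ik) on matrix units *)
Definition slice (V : 'M[C]_(n * n)) (w : 'M[C]_n) : 'M[C]_n :=
  \matrix_(j, l) \sum_(i < n) \sum_(k < n)
      w i k * V (mxvec_index i j) (mxvec_index k l).

Definition Salg (V : 'M[C]_(n * n)) (x : 'M[C]_n) : Prop :=
  exists w : 'M[C]_n, x = slice V w.

Definition coprod (V : 'M[C]_(n * n)) (x : 'M[C]_n) : 'M[C]_(n * n) :=
  V *m tensop x 1%:M *m adjmx V.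

Definition in_tensor (P Q : 'M[C]_n -> Prop) (X : 'M[C]_(n * n)) : Prop :=
  exists (m : nat) (a b : 'I_m -> 'M[C]_n),
    (forall t, P (a t)) /\ (forall t, Q (b t)) /\
    X = \sum_(t < m) tensop (a t) (b t).

Definition subalgebra_of (S B : 'M[C]_n -> Prop) : Prop :=
  (forall x, B x -> S x) /\ B 1%:M /\ B 0 /\
  (forall x y, B x -> B y -> B (x + y)) /\
  (forall (c : C) x, B x -> B (c *: x)) /\
  (forall x y, B x -> B y -> B (x * y)).

Definition left_coideal_subalgebra (V : 'M[C]_(n * n)) (B : 'M[C]_n -> Prop)
  : Prop :=
  subalgebra_of (Salg V) B /\
  forall x, B x -> in_tensor (Salg V) B (coprod V x).

Definition right_coideal_subalgebra (V : 'M[C]_(n * n)) (B : 'M[C]_n -> Prop)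
  : Prop :=
  subalgebra_of (Salg V) B /\
  forall x, B x -> in_tensor B (Salg V) (coprod V x).

Definition free_left_module (B M : 'M[C]_n -> Prop) : Prop :=
  exists (r : nat) (e : 'I_r -> 'M[C]_n),
    (forall t, M (e t)) /\
    (forall s, M s -> exists b : 'I_r -> 'M[C]_n,
        (forall t, B (b t)) /\ s = \sum_(t < r) b t * e t) /\
    (forall b : 'I_r -> 'M[C]_n, (forall t, B (b t)) ->
        \sum_(t < r) b t * e t = 0 -> forall t, b t = 0).

Definition free_right_module (B M : 'M[C]_n -> Prop) : Prop :=
  exists (r : nat) (e : 'I_r -> 'M[C]_n),
    (forall t, M (e t)) /\
    (forall s, M s -> exists b : 'I_r -> 'M[C]_n,
        (forall t, B (b t)) /\ s = \sum_(t < r) e t * b t) /\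
    (forall b : 'I_r -> 'M[C]_n, (forall t, B (b t)) ->
        \sum_(t < r) e t * b t = 0 -> forall t, b t = 0).

End Ops.

(* Main.v *)
(* Let [v i k] be the coefficients of [V] along its first leg: they span [S], and
   the pentagon equation says that [coprod (v i k) = \sum_m v i m (x) v m k]. The
   operator [(id (x) tr) V] is [n] times an idempotent, which by unitarity projects
   onto vectors fixed by [V]; hence [\tr] is a two-sided invariant trace on [S].
   The adjoint of [V] is a polynomial in [V], so that it acts on every coideal and
   the coaction of a coideal subalgebra [B] is invertible. This forces
   - the trace form of [B] to be nondegenerate: its radical is stable under the
     coaction and consists of nilpotent elements, on which the counit vanishes;
   - the character of the regular representation of [B] to be
     [(\dim B / n) *: \tr], because the coaction conjugates multiplication by [x]
     into multiplication by its coproduct.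
   The same holds for [S], so as a [B]-module [S] has the character of
   [\dim S / \dim B] copies of [B]. This ratio is the rank of an idempotent, the
   integral of [B], and equality of characters over the semisimple algebra [B]
   gives the isomorphism. *)
From HB Require Import structures.
Require Import Defs.
From mathcomp Require Import all_boot all_algebra.
From mathcomp Require Import complex boolp reals ring.
Import GRing.Theory Num.Theory.
Local Open Scope ring_scope.

Set Implicit Arguments.
Unset Strict Implicit.
Unset Printing Implicit Defensive.

(** * Linear algebra *)

Section LinearAlgebra.
Variable F : numFieldType.

(** In a full-rank factorization [P = C *m R], idempotence cancels down to [R *m C = 1], an identity
    of size [\rank P]; the trace is cyclic. *)
Lemma mxtrace_idempotent n (P : 'M[F]_n) : P *m P = P -> \tr P = (\rank P)%:R.
Proof.
move=> idP; rewrite -{1}(mulmx_base P) mxtrace_mulC.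
suff -> : row_base P *m col_base P = 1%:M by rewrite mxtrace1.
have fR := row_base_free P; have fC : row_full (col_base P).
  exact: col_base_full.
apply: (row_free_inj fR); apply: (row_full_inj fC).
rewrite mul1mx mulmx_base -[RHS]idP.
by rewrite -[in RHS](mulmx_base P) !mulmxA.
Qed.

(** Bezout yields the Fitting idempotent [e], projecting onto the part where [x] is invertible. It
    is a polynomial in [x] without constant term, so its trace, hence its rank, is 0. *)
Lemma nilpotent_of_trace_exp n (x : 'M[F]_n) :
  (forall k, \tr (x ^+ k.+1) = 0) -> exists k, x ^+ k = 0.
Proof.
case: n x => [|n] x trx; first by exists 0; apply/matrixP => -[].
have p0 : char_poly x != 0 by rewrite monic_neq0 ?char_poly_monic.
have [a [q]] := multiplicity_XsubC (char_poly x) 0; rewrite p0 /= subr0 => q0 Ep.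
(* The exponent is [a.+1] and not [a], so that [e] has no constant term even when [a = 0]. *)
have /Bezout_eq1_coprimepP[[u w] /= uw1] : coprimep q ('X^(a.+1)).
  by rewrite coprimep_expr // -['X]subr0 -polyC0 coprimep_XsubC.
pose e := horner_mx x (w * 'X^(a.+1)).
have ann r : horner_mx x (r * q * 'X^(a)) = 0.
  by rewrite -mulrA -Ep rmorphM /= Cayley_Hamilton mulr0.
have idE : e * e = e.
  rewrite /e -rmorphM; apply/eqP; rewrite -subr_eq0 -rmorphB /=.
  have -> : w * 'X^(a.+1) * (w * 'X^(a.+1)) - w * 'X^(a.+1)
            = - (w * u * 'X) * q * 'X^a.
    by rewrite -[X in _ - X]mulr1 -uw1 exprSr mulrDr mulrACA; ring.
  by rewrite ann.
have tre : \tr e = 0.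
  rewrite /e -[w]coefK poly_def mulr_suml rmorph_sum /= raddf_sum big1 // => i _.
  by rewrite -scalerAl -exprD linearZ /= mxtraceZ rmorphXn /= horner_mx_X addnS trx mulr0.
have e0 : e = 0.
  apply/eqP; rewrite -mxrank_eq0 -(eqr_nat F) -mxtrace_idempotent ?tre //.
exists a; rewrite -{1}[x]horner_mx_X -rmorphXn /=.
have -> : 'X^a = u * q * 'X^a + 'X^a * (w * 'X^(a.+1)) :> {poly F}.
  by rewrite [_ * (_ * _)]mulrC -mulrDl uw1 mul1r.
by rewrite rmorphD /= ann add0r rmorphM /= -/e e0 mulr0.
Qed.

(** The constant coefficient in Cayley-Hamilton is nonzero. Solving for it writes the identity in
    positive powers of [A], and dividing by [A] then gives the inverse. *)
Lemma invmx_closed N (E : 'M[F]_N -> Prop) (A : 'M[F]_N) :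
  E 0 -> (forall X Y, E X -> E Y -> E (X + Y)) ->
  (forall c X, E X -> E (c *: X)) -> (forall X Y, E X -> E Y -> E (X *m Y)) ->
  A \in unitmx -> E A -> E 1%:M /\ E (invmx A).
Proof.
move=> E0 ED EZ EM uA EA; case: N E A E0 ED EZ EM uA EA => [|N] E A E0 ED EZ EM uA EA.
  have eA X : X = A by apply/matrixP => -[].
  by rewrite (eA 1%:M) (eA (invmx _)).
have Esum m (f : 'I_m -> 'M_N.+1) : (forall i, E (f i)) -> E (\sum_i f i).
  by move=> Ef; elim/big_ind: _ => // *; apply: ED.
have Epow k : E (A ^+ k.+1).
  by elim: k => [//|k IH]; rewrite exprS; apply: EM.
set p := char_poly A.
have p0 : p`_0 != 0.
  by rewrite char_poly_det mulf_neq0 ?signr_eq0 // -unitfE -unitmxE.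
have CH : p`_0 *: 1 + \sum_(k < N.+1) p`_k.+1 *: A ^+ k.+1 = 0.
  have Ep : p = \sum_(k < N.+2) p`_k *: 'X^k.
    by rewrite -[LHS]coefK poly_def size_char_poly.
  rewrite -[RHS](Cayley_Hamilton A) -/p [in RHS]Ep.
  rewrite [in RHS]big_ord_recl raddfD raddf_sum /=; congr (_ + _).
    by rewrite linearZ /= rmorph1.
  by apply: eq_bigr => i _; rewrite linearZ /= rmorphXn /= horner_mx_X.
have E1 : E 1%:M.
  have -> : 1%:M = - (p`_0)^-1 *: \sum_(k < N.+1) p`_k.+1 *: A ^+ k.+1.
    move/eqP: CH; rewrite addrC addr_eq0 => /eqP ->.
    by rewrite scalerN scaleNr opprK scalerA mulVf // scale1r.
  by apply: (EZ); apply: (Esum) => k; apply: (EZ).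
split=> //.
have -> : invmx A = - (p`_0)^-1 *: \sum_(k < N.+1) p`_k.+1 *: A ^+ k.
  apply: (can_inj (mulKmx uA)); rewrite mulmxV // -scalemxAr mulmx_sumr.
  transitivity (- (p`_0)^-1 *: \sum_(k < N.+1) p`_k.+1 *: A ^+ k.+1).
    move/eqP: CH; rewrite addrC addr_eq0 => /eqP ->.
    by rewrite scalerN scaleNr opprK scalerA mulVf // scale1r.
  by congr (_ *: _); apply: eq_bigr => k _; rewrite -scalemxAr exprS.
apply: (EZ); apply: (Esum) => -[[|k] ? /=]; apply: (EZ) => //.
Qed.

(** Rows of [B] outside the current span are adjoined, by excluded middle, until none is left; the
    induction is on a bound [k] for the codimension. *)
Lemma subspace_basis N (B : 'rV[F]_N -> Prop) :
  B 0 -> (forall c x y, B x -> B y -> B (c *: x + y)) ->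
  exists m (A : 'M[F]_(m, N)), row_free A /\ (forall x, B x <-> (x <= A)%MS).
Proof.
move=> B0 BL.
have mulB m (A : 'M[F]_(m, N)) : (forall i, B (row i A)) -> forall w, B (w *m A).
  move=> BA w; rewrite mulmx_sum_row; elim/big_rec: _ => // i y _ By; exact: BL.
suff [m [A [BA HA]]] : exists m (A : 'M[F]_(m, N)),
    (forall i, B (row i A)) /\ forall x, B x -> (x <= A)%MS.
  exists (\rank A), (row_base A); split; first exact: row_base_free.
  move=> x; rewrite eq_row_base; split; first exact: HA.
  by case/submxP => w ->; apply: mulB.
suff gen k m (A : 'M[F]_(m, N)) : (forall i, B (row i A)) -> (N - \rank A <= k)%N ->
    exists m (A : 'M[F]_(m, N)), (forall i, B (row i A)) /\ forall x, B x -> (x <= A)%MS.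
  by apply: (gen N 0 0) => [[]|] //; rewrite leq_subr.
elim: k m A => [|k IH] m A BA.
  rewrite leqn0 subn_eq0 => fA; exists m, A; split=> // x _.
  by apply: submx_full; rewrite /row_full eqn_leq rank_leq_col.
move=> lek; have [HA|/existsNP[x /not_implyP[Bx /negP nxA]]] :=
  EM (forall x, B x -> (x <= A)%MS); first by exists m, A.
apply: (IH _ (col_mx A x)) => [i|].
  case: (split_ordP i) => j ->; first by rewrite rowKu.
  by rewrite rowKd (ord1 j) row_id.
have lt : (\rank A < \rank (col_mx A x))%N.
  rewrite -addsmxE; apply: rank_ltmx.
  by rewrite ltmxE addsmxSl addsmx_sub submx_refl.
move: lek lt; set r := \rank A; set r' := \rank _; rewrite !leq_subLR => lek lt.
by rewrite (leq_trans lek) // addnS -addSn leq_add2r.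
Qed.

End LinearAlgebra.

Section PairIndices.
Variables (V : nmodType) (m n : nat).

Lemma unpairK (i : 'I_m) (j : 'I_n) : unpair (mxvec_index i j) = (i, j).
Proof. by rewrite /unpair /mxvec_index cast_ordK enum_rankK. Qed.

Lemma sum_mxvec_index (f : 'I_(m * n) -> V) :
  \sum_p f p = \sum_i \sum_j f (mxvec_index i j).
Proof.
rewrite (reindex _ (curry_mxvec_bij m n)) pair_bigA /=.
by apply: eq_bigr => -[i j].
Qed.

End PairIndices.

(** * Linear maps and traces of operators on matrices *)

Section LinearMaps.
Variable F : numFieldType.

Definition lin (U W : lmodType F) (f : U -> W) :=
  forall c x y, f (c *: x + y) = c *: f x + f y.

Lemma lin0 (U W : lmodType F) (f : U -> W) : lin f -> f 0 = 0.
Proof. by move=> fL; have := fL (-1) 0 0; rewrite scaler0 addr0 scaleN1r addNr. Qed.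

Lemma lin_sum (U W : lmodType F) (f : U -> W) I (r : seq I) (c : I -> F)
    (x : I -> U) :
  lin f -> f (\sum_(i <- r) c i *: x i) = \sum_(i <- r) c i *: f (x i).
Proof.
move=> fL; elim: r => [|i r IH]; first by rewrite !big_nil lin0.
by rewrite !big_cons fL IH.
Qed.

(** The left side is the trace, in the basis of matrix units, of the operator sending [X] to
    [\sum_k A k *m X *m B k], which is a sum of tensor products. *)
Lemma sum_mxtrace d1 d2 I (r : seq I) (A : I -> 'M[F]_d1) (B : I -> 'M[F]_d2) :
  \sum_i \sum_j (\sum_(k <- r) A k *m delta_mx i j *m B k) i j
    = \sum_(k <- r) \tr (A k) * \tr (B k).
Proof.
have entry k i j : (A k *m delta_mx i j *m B k) i j = A k i i * B k j j.
  rewrite mxE (bigD1 j) //= big1 ?addr0 => [|l nlj].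
    rewrite mxE (bigD1 i) //= big1 ?addr0 => [|l nli].
      by rewrite mxE !eqxx mulr1.
    by rewrite mxE (negPf nli) mulr0.
  rewrite mxE big1 ?mul0r // => l' _.
  by rewrite mxE (negPf nlj) andbF mulr0.
transitivity (\sum_i \sum_j \sum_(k <- r) A k i i * B k j j).
  apply: eq_bigr => i _; apply: eq_bigr => j _.
  by rewrite summxE; apply: eq_bigr => k _; rewrite entry.
under eq_bigr do rewrite exchange_big /=.
rewrite exchange_big /=; apply: eq_bigr => k _.
by rewrite mulr_suml; apply: eq_bigr => i _; rewrite mulr_sumr.
Qed.

Lemma mxtrace_lin_mx d1 d2 (f : 'M[F]_(d1, d2) -> 'M[F]_(d1, d2)) :
  \tr (lin_mx f) = \sum_i \sum_j f (delta_mx i j) i j.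
Proof.
rewrite /mxtrace sum_mxvec_index; apply: eq_bigr => i _; apply: eq_bigr => j _.
by rewrite mxE /= mxvecE vec_mx_delta.
Qed.

End LinearMaps.

(** * Duality for the trace form and regular representations *)

Section TraceDuality.
Variables (F : numFieldType) (n : nat).
Implicit Types (B S : 'M[F]_n -> Prop).

Definition subalg B :=
  [/\ B 1%:M, forall c x y, B x -> B y -> B (c *: x + y)
    & forall x y, B x -> B y -> B (x *m y)].

Definition character_on B (eps : 'M[F]_n -> F) :=
  [/\ lin (eps : 'M[F]_n -> F^o), eps 1%:M = 1
    & forall x y, B x -> B y -> eps (x *m y) = eps x * eps y].

Definition dual_bases B m (b b' : 'I_m -> 'M[F]_n) :=
  [/\ (forall i, B (b i)) /\ (forall i, B (b' i)),
      forall y, B y -> y = \sum_k \tr (b' k *m y) *: b k,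
      forall y, B y -> y = \sum_k \tr (y *m b k) *: b' k
    & forall i j, \tr (b' i *m b j) = (i == j)%:R].

(* On such a [B] the trace of the regular representation is
   [m%:R / n%:R * \tr], see [mxtrace_coordrep] *)
Definition trace_frobenius B := exists m (b b' : 'I_m -> 'M[F]_n),
  dual_bases B b b' /\ \sum_k b k *m b' k = (m%:R / n%:R)%:M.

Lemma subalg0 B : subalg B -> B 0.
Proof. by case=> B1 BL _; have := BL (-1) _ _ B1 B1; rewrite scaleN1r addNr. Qed.

Lemma subalg_sum B I (r : seq I) (c : I -> F) (x : I -> 'M[F]_n) :
  subalg B -> (forall i, B (x i)) -> B (\sum_(i <- r) c i *: x i).
Proof.
move=> sB Bx; elim/big_rec: _ => [|i y _ By]; first exact: subalg0.
by case: sB => _ BL _; apply: BL.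
Qed.

(** Transposition realizes the opposite algebra by matrices of the same size; statements on right
    multiplication thus follow from those on left multiplication. *)
Lemma subalg_tr B : subalg B -> subalg (fun x => B x^T).
Proof.
case=> B1 BL BM; split=> [|c x y Bx By|x y Bx By]; first by rewrite trmx1.
  by rewrite linearP; apply: BL.
by rewrite trmx_mul; apply: BM.
Qed.

Lemma character_on_tr B (eps : 'M[F]_n -> F) :
  character_on B eps -> character_on (fun x => B x^T) (fun x => eps x^T).
Proof.
case=> eL e1 eM; split=> [c x y||x y Bx By]; first by rewrite linearP; apply: eL.
  by rewrite trmx1.
by rewrite trmx_mul eM // mulrC.
Qed.

(** The Casimir tensor, the sum of the [b k (x) b' k], is symmetric because the trace form is.
    Transposing the algebra reverses the products, so both orders are needed. *)
Lemma casimir_flip B m (b b' : 'I_m -> 'M[F]_n) :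
  dual_bases B b b' -> \sum_k b' k *m b k = \sum_k b k *m b' k.
Proof.
case=> -[Bb Bb'] exp _ _.
transitivity (\sum_k \sum_l \tr (b' l *m b' k) *: (b l *m b k)).
  apply: eq_bigr => k _; rewrite {1}(exp _ (Bb' k)) mulmx_suml.
  by apply: eq_bigr => l _; rewrite scalemxAl.
rewrite exchange_big /=; apply: eq_bigr => k _.
rewrite {2}(exp _ (Bb' k)) mulmx_sumr; apply: eq_bigr => l _.
by rewrite -scalemxAr mxtrace_mulC.
Qed.

Lemma trace_frobenius_tr B :
  trace_frobenius B -> trace_frobenius (fun x => B x^T).
Proof.
case=> m [b [b' [dB zB]]]; have zB' := casimir_flip dB; case: dB => -[Bb Bb'] exp exp' orth.
exists m, (fun i => (b i)^T), (fun i => (b' i)^T); split; last first.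
  rewrite -tr_scalar_mx -zB -zB' raddf_sum; apply: eq_bigr => k _.
  by rewrite /= trmx_mul.
split=> [|y /exp|y /exp'|i j].
- by split=> i; rewrite trmxK.
- move=> Ey; rewrite -[LHS]trmxK {1}Ey raddf_sum; apply: eq_bigr => k _.
  by rewrite /= linearZ /= -mxtrace_tr trmx_mul trmxK mxtrace_mulC.
- move=> Ey; rewrite -[LHS]trmxK {1}Ey raddf_sum; apply: eq_bigr => k _.
  by rewrite /= linearZ /= -mxtrace_tr trmx_mul trmxK mxtrace_mulC.
by rewrite -trmx_mul mxtrace_tr mxtrace_mulC orth eq_sym.
Qed.

Definition rep B d (rho : 'M[F]_n -> 'M[F]_d) :=
  [/\ lin rho, rho 1%:M = 1%:M
    & forall x y, B x -> B y -> rho (x *m y) = rho x *m rho y].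

(** The matrix of left multiplication by [x] in the basis [b], its coordinates being read off with
    the dual basis. *)
Definition coordrep m (b b' : 'I_m -> 'M[F]_n) (x : 'M[F]_n) : 'M[F]_m :=
  \matrix_(k, j) \tr (b' k *m x *m b j).

(** Separate [B] and [S] cover both the regular representation and the restriction to [B] of the one
    of [S]. *)
Lemma rep_coordrep B S m (s s' : 'I_m -> 'M[F]_n) :
  (forall x, B x -> S x) -> subalg S -> dual_bases S s s' -> rep B (coordrep s s').
Proof.
move=> BS [_ _ SM] [[Ss Ss'] exp _ orth]; split.
- move=> c x y; apply/matrixP => k j.
  by rewrite !mxE mulmxDr mulmxDl mxtraceD -scalemxAr -scalemxAl mxtraceZ.
- by apply/matrixP => k j; rewrite !mxE mulmx1 orth.
move=> x y Bx By; apply/matrixP => k j; rewrite !mxE.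
rewrite -mulmxA -[x *m y *m s j]mulmxA (exp (y *m s j)); last by apply: SM => //; apply: BS.
rewrite mulmxA mulmx_sumr raddf_sum; apply: eq_bigr => l _.
by rewrite !mxE -scalemxAr /= mxtraceZ mulrC [s' l *m _]mulmxA.
Qed.

(** Cyclicity gathers the basis elements into the Casimir sum, which is scalar: the regular
    character is then a multiple of the matrix trace. *)
Lemma mxtrace_coordrep m (b b' : 'I_m -> 'M[F]_n) a x :
  \sum_k b k *m b' k = a%:M -> \tr (coordrep b b' x) = a * \tr x.
Proof.
move=> z; transitivity (\tr (x *m \sum_k b k *m b' k)).
  rewrite mulmx_sumr raddf_sum; apply: eq_bigr => k _.
  by rewrite mxE -mulmxA mxtrace_mulC mulmxA.
by rewrite z mul_mx_scalar mxtraceZ.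
Qed.

(** The block diagonal matrix of [c] blocks [A], that is, the direct sum of [c] copies of a
    representation. *)
Definition copies c d (A : 'M[F]_d) : 'M[F]_(c * d) :=
  \matrix_(p, q) (((unpair p).1 == (unpair q).1)%:R * A (unpair p).2 (unpair q).2).

Lemma mxtrace_copies c d (A : 'M[F]_d) : \tr (copies c A) = c%:R * \tr A.
Proof.
rewrite /mxtrace sum_mxvec_index.
under eq_bigr do under eq_bigr do rewrite mxE unpairK eqxx mul1r.
by rewrite /= sumr_const card_ord mulr_natl.
Qed.

Lemma rep_copies B c d (rho : 'M[F]_n -> 'M[F]_d) :
  rep B rho -> rep B (fun x => copies c (rho x)).
Proof.
case=> rL r1 rM; split.
- by move=> a x y; apply/matrixP => p q; rewrite !mxE rL !mxE mulrDr mulrCA.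
- rewrite r1; apply/matrixP => p q; rewrite !mxE.
  case/mxvec_indexP: p => i j; case/mxvec_indexP: q => k l; rewrite !unpairK /=.
  have -> : (mxvec_index i j == mxvec_index k l) = ((i, j) == (k, l)).
    by apply/eqP/eqP => [/(congr1 (@unpair _ _))|[-> ->]//]; rewrite !unpairK.
  by rewrite xpair_eqE -natrM mulnb.
move=> x y Bx By; rewrite rM //; apply/matrixP => p q; rewrite !mxE sum_mxvec_index.
rewrite (bigD1 (unpair p).1) //= [X in _ + X]big1 ?addr0 => [|i /negPf ni].
  rewrite mulr_sumr; apply: eq_bigr => j _.
  by rewrite !mxE unpairK eqxx mul1r mulrCA.
by apply: big1 => j _; rewrite !mxE unpairK /= eq_sym ni !mul0r.
Qed.

End TraceDuality.

(** * Intertwiners *)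

Section Intertwiners.
Variables (F : numFieldType) (n : nat) (B : 'M[F]_n -> Prop).
Variables (m : nat) (b b' : 'I_m -> 'M[F]_n) (a : F).
Hypotheses (sB : subalg B) (dB : dual_bases B b b').
Hypotheses (zB : \sum_k b k *m b' k = a%:M) (a0 : a != 0).

Definition intertwines d1 d2 (rho : 'M[F]_n -> 'M[F]_d1) (sigma : 'M[F]_n -> 'M[F]_d2)
    (A : 'M[F]_(d1, d2)) := forall x, B x -> rho x *m A = A *m sigma x.

(** The Casimir tensor divided by [a] is a separability idempotent of [B]; this is the resulting
    projection onto intertwiners, as in averaging over a finite group. *)
Definition average d1 d2 (rho : 'M[F]_n -> 'M[F]_d1) (sigma : 'M[F]_n -> 'M[F]_d2)
    (A : 'M[F]_(d1, d2)) := a^-1 *: \sum_k rho (b k) *m A *m sigma (b' k).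

(** Expanding [x *m b k] along [b] and [b' l *m x] along [b'] produces the same coefficients
    [\tr (b' l *m x *m b k)]. *)
Lemma average_intertwines d1 d2 (rho : 'M[F]_n -> 'M[F]_d1)
    (sigma : 'M[F]_n -> 'M[F]_d2) A :
  rep B rho -> rep B sigma -> intertwines rho sigma (average rho sigma A).
Proof.
case=> rL _ rM [sL _ sM] x Bx; case: dB => -[Bb Bb'] exp exp' _.
case: sB => _ _ BM.
rewrite -scalemxAr -scalemxAl mulmx_sumr mulmx_suml; congr (_ *: _).
transitivity (\sum_k \sum_l \tr (b' l *m x *m b k) *: (rho (b l) *m A *m sigma (b' k))).
  apply: eq_bigr => k _; rewrite !mulmxA -rM // (exp (x *m b k)); last exact: BM.
  rewrite (lin_sum _ _ _ rL) !mulmx_suml.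
  by apply: eq_bigr => l _; rewrite -!scalemxAl mulmxA.
rewrite exchange_big /=; apply: eq_bigr => l _.
rewrite -[RHS]mulmxA -sM // [in RHS](exp' (b' l *m x)); last exact: BM.
rewrite (lin_sum _ _ _ sL) mulmx_sumr.
by apply: eq_bigr => k _; rewrite -scalemxAr.
Qed.

Lemma average_id d1 d2 (rho : 'M[F]_n -> 'M[F]_d1) (sigma : 'M[F]_n -> 'M[F]_d2) A :
  rep B rho -> intertwines rho sigma A -> average rho sigma A = A.
Proof.
case=> rL r1 rM iA; case: dB => -[Bb Bb'] _ _ _.
have -> : average rho sigma A = a^-1 *: (rho (\sum_k 1 *: (b k *m b' k)) *m A).
  rewrite lin_sum // mulmx_suml; congr (_ *: _); apply: eq_bigr => k _.
  by rewrite scale1r rM // -!mulmxA iA.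
under eq_bigr do rewrite scale1r.
have rZ c : rho (c%:M) = c%:M.
  by rewrite -[c%:M]addr0 -scalemx1 rL (lin0 rL) r1 addr0 scalemx1.
by rewrite zB rZ mul_scalar_mx scalerA mulVf ?scale1r.
Qed.

Lemma intertwines_mul d1 d2 d3 (r1 : 'M[F]_n -> 'M[F]_d1) (r2 : 'M[F]_n -> 'M[F]_d2)
    (r3 : 'M[F]_n -> 'M[F]_d3) X Y :
  intertwines r1 r2 X -> intertwines r2 r3 Y -> intertwines r1 r3 (X *m Y).
Proof. by move=> iX iY x Bx; rewrite mulmxA iX // -mulmxA iY // mulmxA. Qed.

Lemma intertwines_add d1 d2 (r1 : 'M[F]_n -> 'M[F]_d1) (r2 : 'M[F]_n -> 'M[F]_d2) X Y :
  intertwines r1 r2 X -> intertwines r1 r2 Y -> intertwines r1 r2 (X + Y).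
Proof. by move=> iX iY x Bx; rewrite mulmxDr iX // iY // mulmxDl. Qed.

Lemma intertwines_sub d1 d2 (r1 : 'M[F]_n -> 'M[F]_d1) (r2 : 'M[F]_n -> 'M[F]_d2) X Y :
  intertwines r1 r2 X -> intertwines r1 r2 Y -> intertwines r1 r2 (X - Y).
Proof. by move=> iX iY x Bx; rewrite mulmxBr iX // iY // mulmxBl. Qed.

Lemma average_lin d1 d2 (rho : 'M[F]_n -> 'M[F]_d1) (sigma : 'M[F]_n -> 'M[F]_d2) :
  lin (average rho sigma).
Proof.
move=> c X Y; rewrite /average scalerA mulrC -scalerA -scalerDr; congr (_ *: _).
rewrite scaler_sumr -big_split; apply: eq_bigr => k _ /=.
by rewrite mulmxDr mulmxDl -scalemxAr -scalemxAl.
Qed.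

(* The trace of the idempotent [A |-> P *m average rho rho A *m P] depends only
   on the character of [P], and it is nonzero. *)
Lemma exists_intertwiner d1 d2 (rho : 'M[F]_n -> 'M[F]_d1)
    (sigma : 'M[F]_n -> 'M[F]_d2) (P : 'M_d1) (Q : 'M_d2) :
  rep B rho -> rep B sigma -> P *m P = P -> Q *m Q = Q ->
  intertwines rho rho P -> intertwines sigma sigma Q ->
  (forall x, B x -> \tr (P *m rho x) = \tr (Q *m sigma x)) -> P != 0 ->
  exists g, [/\ intertwines rho sigma g, P *m g = g, g *m Q = g & g != 0].
Proof.
move=> rr rs PP QQ iP iQ trPQ P0; case: (dB) => -[Bb Bb'] _ _ _.
pose h X := P *m average rho sigma X *m Q.
have [/forallP h0|] := boolP [forall i, forall j, h (delta_mx i j) == 0]; last first.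
  case/forallPn => i /forallPn [j hij]; exists (h (delta_mx i j)); split=> //.
  - apply: (intertwines_mul _ iQ); apply: (intertwines_mul iP); exact: average_intertwines.
  - by rewrite /h !mulmxA PP.
  - by rewrite /h -!mulmxA QQ.
pose f X := P *m average rho rho X *m P.
have fL : lin f.
  by move=> c X Y; rewrite /f average_lin mulmxDr mulmxDl -scalemxAr -scalemxAl.
have fi X : intertwines rho rho (f X).
  apply: (intertwines_mul _ iP); apply: (intertwines_mul iP); exact: average_intertwines.
have fP X : P *m X *m P = X -> intertwines rho rho X -> f X = X.
  by move=> PX iX; rewrite /f average_id.
have ff X : f (f X) = f X.
  by apply: fP => //; rewrite /f !mulmxA PP -!mulmxA PP.
(* Equality of characters replaces [P], [rho] by [Q], [sigma] in one factor, which turns the trace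
   of [f] into that of [h], assumed to vanish on matrix units. *)
have trf0 : \tr (lin_mx f) = 0.
  transitivity (a^-1 * \sum_k \tr (P *m rho (b k)) * \tr (Q *m sigma (b' k))).
    rewrite mxtrace_lin_mx.
    under [in RHS]eq_bigr do rewrite -trPQ // [\tr (_ *m rho (b' _))]mxtrace_mulC.
    rewrite -sum_mxtrace mulr_sumr; apply: eq_bigr => i _; rewrite mulr_sumr.
    apply: eq_bigr => j _.
    rewrite /f /average -scalemxAr -scalemxAl mxE; congr (_ * fun_of_matrix _ _ _).
    rewrite mulmx_sumr mulmx_suml; apply: eq_bigr => k _.
    by rewrite !mulmxA.
  under eq_bigr do rewrite [\tr (Q *m _)]mxtrace_mulC.
  rewrite -sum_mxtrace mulr_sumr big1 // => i _; rewrite mulr_sumr big1 // => j _.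
  have /forallP/(_ j)/eqP := h0 i; rewrite /h /average -scalemxAr -scalemxAl.
  move/matrixP/(_ i j); rewrite mxE [RHS]mxE => E; rewrite -[RHS]E.
  congr (_ * fun_of_matrix _ _ _).
  rewrite mulmx_sumr mulmx_suml; apply: eq_bigr => k _.
  by rewrite !mulmxA.
pose fl : {linear 'M[F]_(d1, d1) -> 'M[F]_(d1, d1)} :=
  HB.pack f (GRing.isLinear.Build _ _ _ _ f fL).
have idf : lin_mx f *m lin_mx f = lin_mx f.
  apply/row_matrixP => k; rewrite !rowE mulmxA -[delta_mx _ _]vec_mxK.
  by rewrite (mul_vec_lin fl) (mul_vec_lin fl) /= ff.
have f0 : lin_mx f = 0.
  by apply/eqP; rewrite -mxrank_eq0 -(eqr_nat F) -mxtrace_idempotent ?trf0.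
have := mul_vec_lin fl P; rewrite /= f0 mulmx0 fP ?PP ?PP // => /esym/eqP.
by rewrite mxvec_eq0 (negPf P0).
Qed.

(** Induction on the rank of [P]: a nonzero intertwiner [g] and a generalized inverse [h] of it give
    equivalent idempotents [g *m h] and [h *m g]. Splitting these off keeps the characters equal and
    lowers the rank. *)
Lemma idempotent_equiv d1 d2 (rho : 'M[F]_n -> 'M[F]_d1)
    (sigma : 'M[F]_n -> 'M[F]_d2) (P : 'M_d1) (Q : 'M_d2) :
  rep B rho -> rep B sigma -> P *m P = P -> Q *m Q = Q ->
  intertwines rho rho P -> intertwines sigma sigma Q ->
  (forall x, B x -> \tr (P *m rho x) = \tr (Q *m sigma x)) ->
  exists u v, [/\ intertwines rho sigma u, intertwines sigma rho v,
                  u *m v = P & v *m u = Q].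
Proof.
move=> rr rs; case: (rr) (rs) => [_ rr1 _] [_ rs1 _].
have [k] := ubnP (\rank P); elim: k P Q => [//|k IH] P Q leP PP QQ iP iQ trPQ.
have [P0|P0] := eqVneq P 0.
  (* The characters agree at the identity, so [Q] has the trace, hence the rank, of [P]. *)
  have Q0 : Q = 0.
    apply/eqP; rewrite -mxrank_eq0 -(eqr_nat F) -mxtrace_idempotent //.
    case: sB => /trPQ; rewrite rr1 rs1 !mulmx1 => <- _ _.
    by rewrite P0 mxtrace0.
  exists 0, 0; rewrite P0 Q0 !mul0mx; split=> // x _; by rewrite mul0mx mulmx0.
have [g [ig Pg gQ g0]] := exists_intertwiner rr rs PP QQ iP iQ trPQ P0.
(* A pseudoinverse of [g] need not intertwine; its average does, and still satisfies
   [g *m h1 *m g = g] because [g] moves through the average. *)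
have [h1 [ih1 gh1g Qh1 h1P]] : exists h1, [/\ intertwines sigma rho h1,
    g *m h1 *m g = g, Q *m h1 = h1 & h1 *m P = h1].
  exists (Q *m average sigma rho (pinvmx g) *m P); split.
  - apply: (intertwines_mul _ iP); apply: (intertwines_mul iQ); exact: average_intertwines.
  - rewrite !mulmxA gQ -[_ *m P *m g]mulmxA Pg.
    rewrite -[RHS](average_id rr ig) /average -scalemxAr -scalemxAl mulmx_sumr mulmx_suml.
    case: dB => -[Bb Bb'] _ _ _.
    congr (_ *: _); apply: eq_bigr => l _.
    rewrite -[in RHS](mulmxKpV (submx_refl g)) !mulmxA -ig //.
    by rewrite -[_ *m rho (b' l) *m g]mulmxA [rho (b' l) *m g]ig // !mulmxA.
  - by rewrite !mulmxA QQ.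
  by rewrite -!mulmxA PP.
(* Replacing [h1] by [h1 *m g *m h1] also gives [h *m g *m h = h], which makes the remainders [P']
   and [Q'] orthogonal to [h]. *)
have [h [ih ghg hgh Qh hP]] : exists h, [/\ intertwines sigma rho h,
    g *m h *m g = g, h *m g *m h = h, Q *m h = h & h *m P = h].
  exists (h1 *m g *m h1); split.
  - by apply: (intertwines_mul _ ih1); apply: (intertwines_mul _ ig).
  - by rewrite !mulmxA gh1g gh1g.
  - have h1gh1g : h1 *m g *m h1 *m g = h1 *m g by rewrite -!mulmxA [g *m (_ *m _)]mulmxA gh1g.
    by rewrite !mulmxA !h1gh1g.
  - by rewrite !mulmxA Qh1.
  by rewrite -[LHS]mulmxA h1P.
pose P' := P - g *m h; pose Q' := Q - h *m g.
have P'g : P' *m g = 0 by rewrite mulmxBl Pg ghg subrr.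
have hP' : h *m P' = 0 by rewrite mulmxBr hP mulmxA hgh subrr.
have Q'h : Q' *m h = 0 by rewrite mulmxBl Qh hgh subrr.
have gQ' : g *m Q' = 0 by rewrite mulmxBr gQ mulmxA ghg subrr.
have PP' : P *m P' = P' by rewrite mulmxBr PP mulmxA Pg.
have P'P' : P' *m P' = P' by rewrite {1}/P' mulmxBl PP' -mulmxA hP' mulmx0 subr0.
have Q'Q' : Q' *m Q' = Q'.
  by rewrite {1}/Q' mulmxBl -mulmxA gQ' mulmx0 subr0 mulmxBr QQ mulmxA Qh.
have iP' : intertwines rho rho P' by apply: intertwines_sub => //; apply: (intertwines_mul _ ih).
have iQ' : intertwines sigma sigma Q'.
  by apply: intertwines_sub => //; apply: (intertwines_mul _ ig).
have ltP' : (\rank P' < k)%N.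
  rewrite -ltnS; apply: leq_ltn_trans leP.
  rewrite -(ltr_nat F) -!mxtrace_idempotent // /P' raddfB /= ltrBlDr ltrDl.
  have idgh : g *m h *m (g *m h) = g *m h by rewrite mulmxA ghg.
  rewrite mxtrace_idempotent // ltr0n lt0n mxrank_eq0; apply: contraNneq g0 => gh0.
  by rewrite -ghg gh0 mul0mx.
have trP'Q' x : B x -> \tr (P' *m rho x) = \tr (Q' *m sigma x).
  move=> Bx; rewrite !mulmxBl !raddfB /= trPQ //; congr (_ - _).
  by rewrite -mulmxA -ih // mxtrace_mulC -mulmxA mxtrace_mulC -mulmxA.
have EP : P' + g *m h = P by rewrite subrK.
have EQ : Q' + h *m g = Q by rewrite subrK.
clearbody P' Q'.
have [u [v [iu iv uv vu]]] := IH P' Q' ltP' P'P' Q'Q' iP' iQ' trP'Q'.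
(* Compressing [u] and [v] by [P'] and [Q'] makes the cross terms with [g] and [h] vanish. *)
exists (P' *m u *m Q' + g), (Q' *m v *m P' + h); split.
- apply: intertwines_add => //; apply: (intertwines_mul _ iQ'); exact: (intertwines_mul _ iu).
- apply: intertwines_add => //; apply: (intertwines_mul _ iP'); exact: (intertwines_mul _ iv).
- have t1 : P' *m u *m Q' *m h = 0 by rewrite -!mulmxA Q'h !mulmx0.
  have t2 : g *m (Q' *m v *m P') = 0 by rewrite !mulmxA gQ' !mul0mx.
  have t3 : P' *m u *m Q' *m (Q' *m v *m P') = P'.
    rewrite !mulmxA -[P' *m u *m Q' *m Q']mulmxA Q'Q' -vu !mulmxA.
    by rewrite -[P' *m u *m v]mulmxA uv P'P' -[P' *m u *m v]mulmxA uv !P'P'.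
  by rewrite mulmxDl !mulmxDr t1 t2 t3 addr0 add0r EP.
have t1 : Q' *m v *m P' *m g = 0 by rewrite -!mulmxA P'g !mulmx0.
have t2 : h *m (P' *m u *m Q') = 0 by rewrite !mulmxA hP' !mul0mx.
have t3 : Q' *m v *m P' *m (P' *m u *m Q') = Q'.
  rewrite !mulmxA -[Q' *m v *m P' *m P']mulmxA P'P' -uv !mulmxA.
  by rewrite -[Q' *m v *m u]mulmxA vu Q'Q' -[Q' *m v *m u]mulmxA vu !Q'Q'.
by rewrite mulmxDl !mulmxDr t1 t2 t3 addr0 add0r EQ.
Qed.

End Intertwiners.

(** * Freeness *)

Section Freeness.
Variables (F : numClosedFieldType) (n : nat).
Variables (B S : 'M[F]_n -> Prop) (eps : 'M[F]_n -> F).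
Hypotheses (n0 : (0 < n)%N) (sB : subalg B) (sS : subalg S).
Hypotheses (BS : forall x, B x -> S x) (eB : character_on B eps).
Variables (m : nat) (b b' : 'I_m -> 'M[F]_n).
Hypotheses (dB : dual_bases B b b') (zB : \sum_k b k *m b' k = (m%:R / n%:R)%:M).
Variables (N : nat) (s s' : 'I_N -> 'M[F]_n).
Hypotheses (dS : dual_bases S s s') (zS : \sum_k s k *m s' k = (N%:R / n%:R)%:M).

Let nF0 : n%:R != 0 :> F. Proof. by rewrite pnatr_eq0 -lt0n. Qed.

Lemma dual_bases_gt0 : (0 < m)%N.
Proof.
case: m b b' dB => [|//] c c' [_ exp _ _]; case: sB => /exp.
rewrite big_ord0 => /matrixP/(_ (Ordinal n0) (Ordinal n0)) /eqP.
by rewrite !mxE eqxx oner_eq0.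
Qed.

Let mF0 : m%:R != 0 :> F. Proof. by rewrite pnatr_eq0 -lt0n dual_bases_gt0. Qed.

(* [p := \sum_i eps (b' i) *: b i] satisfies [x *m p = eps x *: p] on [B]; once
   normalized, it is an idempotent acting on [S] with rank [N / m]. *)
Lemma dual_bases_dvd : exists c, (c * m)%N = N.
Proof.
case: (sB) => B1 BL BM; case: (eB) => eL e1 eM.
case: (dB) => -[Bb Bb'] exp exp' _.
have eZ c x : eps (c *: x) = c * eps x.
  have := lin_sum (index_enum 'I_1) (fun=> c) (fun=> x) eL.
  by rewrite !big_ord1.
pose p := \sum_i eps (b' i) *: b i.
have Bp : B p by apply: subalg_sum.
have xp x : B x -> x *m p = eps x *: p.
  move=> Bx; rewrite mulmx_sumr.
  transitivity (\sum_i \sum_j (\tr (b' j *m x *m b i) * eps (b' i)) *: b j).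
    apply: eq_bigr => i _; rewrite -scalemxAr (exp (x *m b i)); last exact: BM.
    rewrite scaler_sumr; apply: eq_bigr => j _.
    by rewrite scalerA mulrC mulmxA.
  rewrite exchange_big scaler_sumr /=; apply: eq_bigr => j _.
  rewrite -scaler_suml scalerA; congr (_ *: _).
  rewrite mulrC -eM // [in RHS](exp' (b' j *m x)); last exact: BM.
  by rewrite (lin_sum _ _ _ eL).
(* The values of [eps] commute, so [eps p] is the value of [eps] on the Casimir sum; this fixes the
   normalization of [q] below. *)
have ep : eps p = m%:R / n%:R.
  transitivity (eps (\sum_i 1 *: (b i *m b' i))).
    rewrite !(lin_sum _ _ _ eL); apply: eq_bigr => i _.
    by rewrite scale1r eM // mulrC.
  under eq_bigr do rewrite scale1r.
  by rewrite zB -scalemx1 eZ e1 mulr1.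
(* Apply [eps] to the expansion of the identity along [b']. *)
have tp : \tr p = 1.
  rewrite -e1 [in RHS](exp' _ B1) (lin_sum _ _ _ eL) raddf_sum.
  by apply: eq_bigr => i _; rewrite /= mxtraceZ mul1mx mulrC.
pose q := (n%:R / m%:R) *: p.
have BZ c x : B x -> B (c *: x).
  move=> Bx; have -> : c *: x = (c - 1) *: x + x by rewrite scalerBl scale1r subrK.
  exact: BL.
have Bq : B q by apply: BZ.
have qq : q *m q = q.
  rewrite -scalemxAl -scalemxAr xp // ep !scalerA; congr (_ *: _); field.
  by rewrite nF0 mF0.
have [_ _ rM] := rep_coordrep BS sS dS.
have idq : coordrep s s' q *m coordrep s s' q = coordrep s s' q by rewrite -rM // qq.
exists (\rank (coordrep s s' q)).
apply/eqP; rewrite -(eqr_nat F) natrM -mxtrace_idempotent // (mxtrace_coordrep _ zS).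
by rewrite mxtraceZ tp; apply/eqP; field; rewrite nF0 mF0.
Qed.

(** On [S] and on [c] copies of [B], the character of [B] is [N%:R / n%:R * \tr], since [c * m = N].
    The equivalence of the identity idempotents is then a module isomorphism. *)
Lemma free_left_dual_bases : free_left_module B S.
Proof.
have [c cm] := dual_bases_dvd.
case: (sB) => B1 BL BM; case: (dB) => -[Bb Bb'] exp exp' orth.
case: (dS) => -[Ss Ss'] expS _ orthS.
pose rho := coordrep s s'; pose sigma x := copies c (coordrep b b' x).
have rr : rep B rho by exact: (rep_coordrep BS sS dS).
have rs : rep B sigma by apply: rep_copies; exact: (rep_coordrep _ sB dB).
have a0 : m%:R / n%:R != 0 :> F by rewrite mulf_neq0 ?invr_eq0.
have [u [v [iu iv uv vu]]] :
    exists u v, [/\ intertwines B rho sigma u, intertwines B sigma rho v,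
                    u *m v = 1%:M & v *m u = 1%:M].
  apply: (idempotent_equiv sB dB zB a0 rr rs); rewrite ?mul1mx //.
  - by move=> x _; rewrite mul1mx mulmx1.
  - by move=> x _; rewrite mul1mx mulmx1.
  move=> x Bx; rewrite !mul1mx mxtrace_copies !(mxtrace_coordrep _ zB) (mxtrace_coordrep _ zS).
  by rewrite -cm natrM; ring.
(* [g t j] is the image in [S] of the basis vector [b j] of the copy [t], and [e t] that of the
   identity, whose coordinates along [b] are the [\tr (b' j)]. *)
pose g t j := \sum_i u i (mxvec_index t j) *: s i.
pose e t := \sum_j \tr (b' j) *: g t j.
have Sg t j : S (g t j) by apply: subalg_sum.
have xg x t j : B x -> x *m g t j = \sum_k \tr (b' k *m x *m b j) *: g t k.
  move=> Bx; have [_ _ SM] := sS.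
  have Sx := BS Bx.
  transitivity (\sum_i (rho x *m u) i (mxvec_index t j) *: s i).
    rewrite mulmx_sumr.
    transitivity (\sum_i \sum_k (u i (mxvec_index t j) * rho x k i) *: s k).
      apply: eq_bigr => i _; rewrite -scalemxAr (expS (x *m s i)); last exact: SM.
      rewrite scaler_sumr; apply: eq_bigr => k _.
      by rewrite mxE scalerA mulmxA.
    rewrite exchange_big /=; apply: eq_bigr => k _; rewrite mxE scaler_suml.
    by apply: eq_bigr => i _; rewrite mulrC.
  rewrite iu //.
  under eq_bigr do rewrite mxE scaler_suml.
  rewrite exchange_big /= sum_mxvec_index (bigD1 t) //= [X in _ + X]big1 ?addr0.
    apply: eq_bigr => k _; rewrite /g scaler_sumr; apply: eq_bigr => i _.
    by rewrite !mxE !unpairK eqxx mul1r scalerA mulrC.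
  move=> t' /negPf nt; rewrite big1 // => k _; rewrite big1 // => i _.
  by rewrite !mxE !unpairK /= nt mul0r mulr0 scale0r.
have xe x t : B x -> x *m e t = \sum_k \tr (b' k *m x) *: g t k.
  move=> Bx; rewrite mulmx_sumr.
  transitivity (\sum_j \sum_k (\tr (b' j) * \tr (b' k *m x *m b j)) *: g t k).
    apply: eq_bigr => j _; rewrite -scalemxAr xg // scaler_sumr.
    by apply: eq_bigr => k _; rewrite scalerA.
  rewrite exchange_big /=; apply: eq_bigr => k _; rewrite -scaler_suml; congr (_ *: _).
  rewrite -[in RHS](mulmx1 x) [in RHS](exp _ B1) !mulmx_sumr raddf_sum.
  by apply: eq_bigr => j _; rewrite /= -!scalemxAr mxtraceZ mulmx1 mulmxA.
(* The coordinates of the combination along [s] are [u] applied to those of [f]. Hence [u *m v = 1]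
   gives spanning and [v *m u = 1] gives independence. *)
have sume (f : 'I_c -> 'M_n) : (forall t, B (f t)) ->
    \sum_t f t *m e t
    = \sum_i (\sum_t \sum_k u i (mxvec_index t k) * \tr (b' k *m f t)) *: s i.
  move=> Bf; under eq_bigr do rewrite xe //.
  under [RHS]eq_bigr do rewrite scaler_suml.
  rewrite [RHS]exchange_big /=; apply: eq_bigr => t _.
  under [RHS]eq_bigr do rewrite scaler_suml.
  rewrite [RHS]exchange_big /=; apply: eq_bigr => k _.
  by rewrite scaler_sumr; apply: eq_bigr => i _; rewrite scalerA mulrC.
exists c, e; split; [|split].
- by move=> t; apply: subalg_sum.
- move=> y Sy; pose w : 'cV_N := \col_i \tr (s' i *m y).
  pose f t := \sum_k (v *m w) (mxvec_index t k) 0 *: b k.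
  have Bf t : B (f t) by apply: subalg_sum.
  exists f; split=> //; rewrite [RHS]sume // {1}(expS _ Sy).
  apply: eq_bigr => i _; congr (_ *: _).
  transitivity ((u *m v *m w) i 0); first by rewrite uv mul1mx mxE.
  rewrite -mulmxA mxE sum_mxvec_index; apply: eq_bigr => t _; apply: eq_bigr => k _.
  congr (_ * _); rewrite mulmx_sumr raddf_sum (bigD1 k) //= big1 ?addr0.
    by rewrite -scalemxAr mxtraceZ orth eqxx mulr1.
  by move=> l /negPf nl; rewrite -scalemxAr mxtraceZ orth eq_sym nl mulr0.
move=> f Bf; rewrite [LHS]sume // => f0.
pose w : 'cV_(c * m) := \col_p \tr (b' (unpair p).2 *m f (unpair p).1).
have uw : u *m w = 0.
  apply/colP => i; rewrite mxE [RHS]mxE sum_mxvec_index.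
  have := congr1 (fun X => \tr (s' i *m X)) f0; rewrite /= mulmx0 mxtrace0 => E.
  rewrite -[RHS]E mulmx_sumr raddf_sum [in RHS](bigD1 i) //= [X in _ = _ + X]big1 ?addr0.
    rewrite -scalemxAr mxtraceZ orthS eqxx mulr1.
    by apply: eq_bigr => t _; apply: eq_bigr => k _; rewrite mxE unpairK.
  by move=> j /negPf nj; rewrite -scalemxAr mxtraceZ orthS eq_sym nj mulr0.
have w0 : w = 0 by rewrite -[w]mul1mx -vu -mulmxA uw mulmx0.
move=> t; rewrite (exp _ (Bf t)) big1 // => k _.
have := congr1 (fun X : 'cV_ _ => X (mxvec_index t k) 0) w0.
by rewrite /= !mxE unpairK /= => ->; rewrite scale0r.
Qed.

End Freeness.

(** Right freeness is left freeness of the transposed algebras, transposed back. *)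
Lemma free_left_right_module (F : numClosedFieldType) n (B S : 'M[F]_n -> Prop)
    (eps : 'M[F]_n -> F) :
  (0 < n)%N -> subalg B -> subalg S -> (forall x, B x -> S x) ->
  character_on B eps -> trace_frobenius B -> trace_frobenius S ->
  free_left_module B S /\ free_right_module B S.
Proof.
move=> n0 sB sS BS eB fB fS; split.
  by case: fB fS => m [b [b' [dB zB]]] [N [s [s' [dS zS]]]];
     exact: (free_left_dual_bases n0 sB sS BS eB dB zB dS zS).
have {fB} [m [b [b' [dB zB]]]] := trace_frobenius_tr fB.
have {fS} [N [s [s' [dS zS]]]] := trace_frobenius_tr fS.
have [r [e [Se [span free]]]] := free_left_dual_bases n0 (subalg_tr sB) (subalg_tr sS)
  (fun x => BS x^T) (character_on_tr eB) dB zB dS zS.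
exists r, (fun t => (e t)^T); split=> //; split.
  move=> y; rewrite -{1}[y]trmxK => /span [f [Bf Ef]].
  exists (fun t => (f t)^T); split=> //; rewrite -[LHS]trmxK Ef raddf_sum.
  by apply: eq_bigr => t _; exact: trmx_mul.
move=> f Bf Ef t; rewrite -[LHS]trmxK (free (fun t => (f t)^T)) ?trmx0 //.
  by move=> i; rewrite trmxK.
transitivity ((\sum_(t < r) (e t)^T * f t)^T); last by rewrite Ef trmx0.
rewrite raddf_sum; apply: eq_bigr => i _.
by rewrite -{1}[e i]trmxK; apply/esym; exact: trmx_mul.
Qed.

(** * Coactions *)

Section DualBases.
Variables (F : numFieldType) (n : nat) (B : 'M[F]_n -> Prop).
Hypothesis sB : subalg B.

(** The dual basis comes from the inverse Gram matrix of the trace form: a null vector of the Gram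
    matrix would give an element of the radical. *)
Lemma exists_dual_bases :
  (forall x, B x -> (forall y, B y -> \tr (x *m y) = 0) -> x = 0) ->
  exists m (b b' : 'I_m -> 'M[F]_n), dual_bases B b b'.
Proof.
move=> nondeg; case: (sB) => B1 BL BM.
have B0 := subalg0 sB.
have [||m [A [fA BA]]] := @subspace_basis F _ (fun r => B (vec_mx r)).
- by rewrite linear0.
- by move=> c x y Bx By; rewrite linearP; apply: BL.
pose b i := vec_mx (row i A) : 'M[F]_n.
have vecA (w : 'rV_m) : vec_mx (w *m A) = \sum_i w 0 i *: b i.
  by rewrite mulmx_sum_row linear_sum; apply: eq_bigr => i _; rewrite linearZ.
have Bb i : B (b i) by apply/BA; rewrite row_sub.
have spanb y : B y -> exists w : 'rV_m, y = \sum_i w 0 i *: b i.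
  rewrite -{1}[y]mxvecK => /BA/submxP[w Ew]; exists w.
  by rewrite -vecA -Ew mxvecK.
pose G : 'M[F]_m := \matrix_(i, j) \tr (b i *m b j).
have uG : G \in unitmx.
  rewrite -row_free_unit; apply: inj_row_free => w wG.
  apply: (row_free_inj fA); rewrite mul0mx; apply: (can_inj vec_mxK); rewrite linear0.
  apply: nondeg => [|y /spanb[v ->]]; first by rewrite vecA; apply: subalg_sum.
  rewrite mulmx_sumr raddf_sum big1 // => j _; rewrite /= -scalemxAr mxtraceZ.
  rewrite vecA mulmx_suml raddf_sum; apply/eqP; rewrite mulf_eq0; apply/orP; right.
  have /rowP/(_ j) := wG; rewrite [RHS]mxE => E; apply/eqP; rewrite -[RHS]E mxE.
  by apply: eq_bigr => i _; rewrite /= -scalemxAl mxtraceZ mxE.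
pose b' i := \sum_k invmx G i k *: b k.
have Bb' i : B (b' i) by apply: subalg_sum.
have orth i j : \tr (b' i *m b j) = (i == j)%:R.
  have /matrixP/(_ i j) := mulVmx uG; rewrite !mxE => <-.
  rewrite mulmx_suml raddf_sum; apply: eq_bigr => k _.
  by rewrite /= -scalemxAl mxtraceZ mxE.
have orth' i (c : 'I_m -> F) : \tr (b' i *m \sum_k c k *: b k) = c i.
  rewrite mulmx_sumr raddf_sum (bigD1 i) //= big1 ?addr0.
    by rewrite -scalemxAr mxtraceZ orth eqxx mulr1.
  by move=> k /negPf nk; rewrite -scalemxAr mxtraceZ orth eq_sym nk mulr0.
exists m, b, b'; split=> //.
  by move=> y /spanb[w ->]; apply: eq_bigr => i _; rewrite orth'.
move=> y By; apply/eqP; rewrite -subr_eq0; apply/eqP; apply: nondeg.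
  by rewrite addrC -scaleN1r; apply: BL => //; apply: subalg_sum.
move=> x /spanb[w ->]; rewrite mulmx_sumr raddf_sum big1 // => j _.
rewrite /= -scalemxAr mxtraceZ mulmxBl raddfB /=.
suff -> : \tr ((\sum_k \tr (y *m b k) *: b' k) *m b j) = \tr (y *m b j).
  by rewrite subrr mulr0.
rewrite mulmx_suml raddf_sum (bigD1 j) //= big1 ?addr0.
  by rewrite -scalemxAl mxtraceZ orth eqxx mulr1.
by move=> k /negPf nk; rewrite -scalemxAl mxtraceZ orth nk mulr0.
Qed.

(** Each side is the trace of an operator on the subspace [B], computed in dual bases; this is
    cyclicity of that trace. *)
Lemma dual_bases_trace_mulC m (b b' : 'I_m -> 'M[F]_n) (T U : 'M[F]_n -> 'M[F]_n) :
  dual_bases B b b' -> lin T -> lin U ->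
  (forall x, B x -> B (T x)) -> (forall x, B x -> B (U x)) ->
  \sum_i \tr (b' i *m T (U (b i))) = \sum_i \tr (b' i *m U (T (b i))).
Proof.
case=> -[Bb _] exp _ _.
have E (T' U' : 'M[F]_n -> 'M[F]_n) : lin T' -> (forall x, B x -> B (U' x)) ->
    \sum_i \tr (b' i *m T' (U' (b i)))
    = \sum_i \sum_j \tr (b' j *m U' (b i)) * \tr (b' i *m T' (b j)).
  move=> T'L U'B; apply: eq_bigr => i _.
  rewrite [in LHS](exp _ (U'B _ (Bb i))) (lin_sum _ _ _ T'L) mulmx_sumr raddf_sum.
  by apply: eq_bigr => j _; rewrite /= -scalemxAr mxtraceZ.
move=> TL UL TB UB; rewrite (E T U) // (E U T) // exchange_big /=.
by apply: eq_bigr => i _; apply: eq_bigr => j _; rewrite mulrC.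
Qed.

End DualBases.

(** * Invertible coactions on [B], given by coefficients [D] with inverse [D'] *)

Section Coaction.
Variables (F : numFieldType) (n : nat) (B : 'M[F]_n -> Prop).
Variables (D D' : 'I_n -> 'I_n -> 'M[F]_n -> 'M[F]_n) (eps : 'M[F]_n -> F).
Hypotheses (n0 : (0 < n)%N) (sB : subalg B) (eB : character_on B eps).
Hypotheses (DL : forall j l, lin (D j l)) (D'L : forall j l, lin (D' j l)).
Hypotheses (DB : forall j l x, B x -> B (D j l x))
           (D'B : forall j l x, B x -> B (D' j l x)).
Hypothesis DM : forall j l x y, B x -> B y ->
  D j l (x *m y) = \sum_m D j m x *m D m l y.
Hypotheses
  (DD' : forall j l x, B x -> \sum_m D j m (D' m l x) = (j == l)%:R *: x)
  (D'D : forall j l x, B x -> \sum_m D' j m (D m l x) = (j == l)%:R *: x).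
Hypotheses
  (trD : forall j l x, B x -> \tr (D j l x) = (j == l)%:R * \tr x)
  (Dtr : forall x, B x -> \sum_m D m m x = (\tr x)%:M).
Hypothesis eD : forall x, B x -> x = \matrix_(j, l) eps (D j l x).

(** Multiplicativity of [D] splits the right side, and [D'] then cancels against [D], playing the
    part of an antipode. *)
Lemma coaction_mull j k x y : B x -> B y ->
  D j k x *m y = \sum_l D j l (x *m D' l k y).
Proof.
move=> Bx By.
under eq_bigr => l _ do rewrite (DM _ _ Bx (D'B _ _ By)).
rewrite exchange_big /=.
under eq_bigr => m _ do rewrite -mulmx_sumr (DD' _ _ By).
rewrite (bigD1 k) //= eqxx scale1r big1 ?addr0 // => m /negPf ->.
by rewrite scale0r mulmx0.
Qed.

(* The radical of the trace form is stable under [D], and its elements are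
   nilpotent, so that [eps] vanishes on it. *)
Lemma coaction_nondegenerate x :
  B x -> (forall y, B y -> \tr (x *m y) = 0) -> x = 0.
Proof.
move=> Bx x0; case: (sB) => B1 BL BM; case: eB => eL e1 eM.
have Bexp y k : B y -> B (y ^+ k).
  by move=> By; elim: k => [//|k IH]; rewrite exprS; apply: BM.
have e0 := lin0 eL.
have erad y : B y -> (forall z, B z -> \tr (y *m z) = 0) -> eps y = 0.
  move=> By y0.
  have [k yk] : exists k, y ^+ k = 0.
    by apply: nilpotent_of_trace_exp => k; rewrite exprS; apply: y0; apply: Bexp.
  have eX l : eps (y ^+ l) = eps y ^+ l.
    elim: l => [|l IH]; first by rewrite !expr0 -e1.
    by rewrite !exprS -IH -eM //; apply: Bexp.
  by apply/eqP; move: (eX k); rewrite yk e0 => /esym/eqP; rewrite expf_eq0 => /andP[].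
(* The scalars [eps (D j l x)] determine [x]. By [coaction_mull] and the invariance of the trace,
   each [D j l x] is again in the radical. *)
rewrite (eD Bx); apply/matrixP => j l; rewrite !mxE; apply: erad => [|z Bz]; first exact: DB.
rewrite coaction_mull // raddf_sum (bigD1 j) //= trD; last by apply: (BM) => //; apply: D'B.
rewrite x0 ?mulr0 ?add0r; last exact: D'B.
by rewrite big1 // => m nm; rewrite trD ?x0 ?mulr0 //; [exact: D'B | apply: (BM) => //; exact: D'B].
Qed.

(* [D] conjugates left multiplication by [x] into left multiplication by the
   coproduct of [x]; taking traces, the invariance [Dtr] gives the character of
   the regular representation. *)
Lemma coaction_frobenius : trace_frobenius B.
Proof.
have [m [b [b' dB]]] := exists_dual_bases sB coaction_nondegenerate.
exists m, b, b'; split=> //.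
have nF0 : n%:R != 0 :> F by rewrite pnatr_eq0 -lt0n.
case: (sB) => B1 BL BM; case: (dB) => -[Bb Bb'] exp exp' orth.
have Dprod j l x : B x -> lin (fun y => D j l (x *m y)).
  by move=> Bx c y z; rewrite mulmxDr -scalemxAr DL.
have key x : B x ->
    n%:R * (\sum_i \tr (b' i *m (x *m b i))) = m%:R * \tr x.
  move=> Bx.
  transitivity (\sum_j \sum_i \tr (b' i *m (D j j x *m b i))).
    transitivity (\sum_j \sum_l \sum_i \tr (b' i *m D j l (x *m D' l j (b i)))).
      (* Cyclicity brings [D'] next to [D], where they cancel; one copy of multiplication by [x] is
         left for each [l], whence the factor [n]. *)
      have flip j l : \sum_i \tr (b' i *m D j l (x *m D' l j (b i)))
          = \sum_i \tr (b' i *m D' l j (D j l (x *m b i))).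
        apply: (dual_bases_trace_mulC (T := fun y => D j l (x *m y)) (U := D' l j) dB).
        - exact: Dprod.
        - exact: D'L.
        - by move=> y By; apply: DB; apply: BM.
        - by move=> y; apply: D'B.
      under [RHS]eq_bigr => j _ do under eq_bigr => l _ do rewrite flip.
      rewrite [RHS]exchange_big /=.
      transitivity (\sum_(l < n) \sum_i \tr (b' i *m (x *m b i))).
        by rewrite sumr_const card_ord mulr_natl.
      apply: eq_bigr => l _; rewrite [RHS]exchange_big /=; apply: eq_bigr => i _.
      transitivity (\tr (b' i *m \sum_j D' l j (D j l (x *m b i)))).
        by rewrite D'D ?eqxx ?scale1r //; apply: BM.
      by rewrite mulmx_sumr raddf_sum.
    apply: eq_bigr => j _; rewrite [LHS]exchange_big /=; apply: eq_bigr => i _.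
    by rewrite coaction_mull // mulmx_sumr raddf_sum.
  rewrite exchange_big /=.
  transitivity (\sum_(i < m) \tr x); last by rewrite sumr_const card_ord mulr_natl.
  apply: eq_bigr => i _.
  transitivity (\tr (b' i *m ((\sum_j D j j x) *m b i))).
    by rewrite mulmx_suml mulmx_sumr raddf_sum.
  by rewrite Dtr // mul_scalar_mx -scalemxAr mxtraceZ orth eqxx mulr1.
have BZ c y : B y -> B (c *: y).
  by move=> By; rewrite -[c *: y](subrK y) -{2}[y]scale1r -scalerBl; apply: BL.
(* [key] says that the Casimir sum and the scalar [m%:R / n%:R] have the same trace pairing with
   every [x] in [B]; nondegeneracy identifies them. *)
apply/eqP; rewrite -subr_eq0; apply/eqP; apply: coaction_nondegenerate.
  rewrite addrC -scalemx1 -scaleNr; apply: BL => //.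
  have -> : \sum_k b k *m b' k = \sum_k 1 *: (b k *m b' k).
    by apply: eq_bigr => k _; rewrite scale1r.
  by apply: subalg_sum => // k; apply: BM.
move=> x Bx; rewrite mulmxBl raddfB /= mul_scalar_mx mxtraceZ.
apply/eqP; rewrite subr_eq0; apply/eqP.
apply: (mulfI nF0); rewrite mulrA mulrCA mulfV // mulr1 -key //; congr (_ * _).
rewrite mulmx_suml raddf_sum; apply: eq_bigr => k _ /=.
by rewrite -mulmxA mxtrace_mulC mulmxA mxtrace_mulC -?mulmxA.
Qed.

End Coaction.

(** * Multiplicative unitaries *)

Section Legs.
Variables (C : numClosedFieldType) (n : nat).
Implicit Types (X Y V : 'M[C]_(n * n)) (A B : 'M[C]_n).

(** The coefficient of the matrix unit [(i, k)] of the first leg; [slice2] does the same for the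
    second leg. In both cases slices multiply like blocks of a matrix. *)
Definition slice1 X (i k : 'I_n) : 'M[C]_n :=
  \matrix_(j, l) X (mxvec_index i j) (mxvec_index k l).
Definition slice2 X (j l : 'I_n) : 'M[C]_n :=
  \matrix_(i, k) X (mxvec_index i j) (mxvec_index k l).

Lemma slice1_inj X Y : (forall i k, slice1 X i k = slice1 Y i k) -> X = Y.
Proof.
move=> XY; apply/matrixP => p q.
case/mxvec_indexP: p => i j; case/mxvec_indexP: q => k l.
by have /matrixP/(_ j l) := XY i k; rewrite !mxE.
Qed.

Lemma slice1_mul X Y i k :
  slice1 (X *m Y) i k = \sum_m slice1 X i m *m slice1 Y m k.
Proof.
apply/matrixP => j l; rewrite !mxE sum_mxvec_index summxE.
by apply: eq_bigr => m _; rewrite mxE; apply: eq_bigr => r _; rewrite !mxE.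
Qed.

Lemma slice2_mul X Y j l :
  slice2 (X *m Y) j l = \sum_m slice2 X j m *m slice2 Y m l.
Proof.
apply/matrixP => i k; rewrite !mxE sum_mxvec_index exchange_big summxE /=.
by apply: eq_bigr => m _; rewrite mxE; apply: eq_bigr => r _; rewrite !mxE.
Qed.

Lemma slice1_lin i k : lin (fun X => slice1 X i k).
Proof. by move=> c X Y; apply/matrixP => j l; rewrite !mxE. Qed.

Lemma slice2_lin j l : lin (fun X => slice2 X j l).
Proof. by move=> c X Y; apply/matrixP => i k; rewrite !mxE. Qed.

Lemma slice1_tensop A B i k : slice1 (tensop A B) i k = A i k *: B.
Proof. by apply/matrixP => j l; rewrite !mxE !unpairK. Qed.

Lemma slice2_tensop A B j l : slice2 (tensop A B) j l = B j l *: A.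
Proof. by apply/matrixP => i k; rewrite !mxE !unpairK mulrC. Qed.

Lemma tensop11 : tensop 1%:M 1%:M = 1%:M :> 'M[C]_(n * n).
Proof.
apply/matrixP => p q; case/mxvec_indexP: p => i j; case/mxvec_indexP: q => k l.
rewrite !mxE !unpairK /= -natrM mulnb -xpair_eqE.
congr (_ _)%:R; apply/eqP/eqP => [[-> ->]//|].
by move/(congr1 (@unpair _ _)); rewrite !unpairK.
Qed.

Lemma slice2_1 j l : slice2 1%:M j l = (j == l)%:R%:M.
Proof. by rewrite -tensop11 slice2_tensop mxE scalemx1. Qed.

Lemma tensop_mulr1 A B : tensop A 1%:M *m tensop B 1%:M = tensop (A *m B) 1%:M.
Proof.
apply: slice1_inj => i k; rewrite slice1_mul slice1_tensop mxE scaler_suml.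
by apply: eq_bigr => m _; rewrite !slice1_tensop -scalemxAl mul1mx scalerA.
Qed.

Lemma tensop_lin : lin (fun A => tensop A 1%:M).
Proof.
by move=> c A B; apply: slice1_inj => i k; rewrite slice1_lin !slice1_tensop !mxE scalerDl scalerA.
Qed.

Lemma mxtrace_slice1 X : \tr X = \sum_i \tr (slice1 X i i).
Proof.
by rewrite /mxtrace sum_mxvec_index; apply: eq_bigr => i _; apply: eq_bigr => j _; rewrite mxE.
Qed.

Lemma mxtrace_tensop A B : \tr (tensop A B) = \tr A * \tr B.
Proof.
rewrite mxtrace_slice1 mulr_suml; apply: eq_bigr => i _.
by rewrite slice1_tensop mxtraceZ.
Qed.

(** The matrix on the right is the partial trace of [X] over the second leg. *)
Lemma mxtrace_mul_tensop1 X A :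
  \tr (X *m tensop A 1%:M) = \tr (\matrix_(i, k) \tr (slice1 X i k) *m A).
Proof.
rewrite mxtrace_slice1; apply: eq_bigr => i _; rewrite slice1_mul raddf_sum mxE.
apply: eq_bigr => k _; rewrite /= slice1_tensop scalemx1 mul_mx_scalar mxtraceZ mxE.
by rewrite mulrC.
Qed.

Lemma adjmx_mul m (A B : 'M[C]_m) : adjmx (A *m B) = adjmx B *m adjmx A.
Proof. by rewrite /adjmx trmx_mul map_mxM. Qed.

Lemma adjmxK m (A : 'M[C]_m) : adjmx (adjmx A) = A.
Proof. by apply/matrixP => i j; rewrite !mxE conjCK. Qed.

Lemma adjmxB m (A B : 'M[C]_m) : adjmx (A - B) = adjmx A - adjmx B.
Proof. by rewrite /adjmx raddfB map_mxB. Qed.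

Lemma mxtrace_adj m (A : 'M[C]_m) : \tr (adjmx A) = (\tr A)^*.
Proof. by rewrite /adjmx trace_map_mx mxtrace_tr. Qed.

Lemma adjmx_tensop1 A : adjmx (tensop A 1%:M) = tensop (adjmx A) 1%:M.
Proof.
by apply/matrixP => p q; rewrite !mxE rmorphM /= conjC_nat eq_sym.
Qed.

Lemma mxtrace_adj_mul_eq0 m (A : 'M[C]_m) : \tr (adjmx A *m A) = 0 -> A = 0.
Proof.
move=> tr0; have E : \sum_j \sum_i `|A i j| ^+ 2 = 0.
  rewrite -[RHS]tr0; apply: eq_bigr => j _; rewrite mxE; apply: eq_bigr => i _.
  by rewrite !mxE normCK mulrC.
have ge0 j : 0 <= \sum_i `|A i j| ^+ 2 by apply: sumr_ge0 => i _; rewrite exprn_ge0.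
apply/matrixP => i j; rewrite mxE; apply/eqP; rewrite -normr_eq0 -sqrf_eq0.
have /psumr_eq0P/(_ j isT) := E; move/(_ (fun j _ => ge0 j)) => Ej.
have /psumr_eq0P/(_ i isT) := Ej; move/(_ (fun i _ => exprn_ge0 2 (normr_ge0 _))) => ->.
by [].
Qed.

End Legs.

(** * The pentagon equation and the coproduct in coordinates *)

Section MultiplicativeUnitary.
Variables (C : numClosedFieldType) (n : nat) (V : 'M[C]_(n * n)).
Hypothesis mV : multiplicative_unitary V.

Let W := adjmx V.
Let v := slice1 V.
Let u := slice2 V.

(** The entry of the pentagon at row [(a, b, c)] and column [(d, e, f)], with the identity legs
    summed out. *)
Lemma pentagon_coef (a b c d e f : 'I_n) :
  \sum_p \sum_q \sum_r V (mxvec_index a b) (mxvec_index p q) *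
     V (mxvec_index p c) (mxvec_index d r) * V (mxvec_index q r) (mxvec_index e f)
  = \sum_q V (mxvec_index b c) (mxvec_index q f) * V (mxvec_index a q) (mxvec_index d e).
Proof.
case: mV => _ /matrixP/(_ (mxvec_index (mxvec_index a b) c) (mxvec_index (mxvec_index d e) f)).
pose t i j k : 'I_(n * n * n) := mxvec_index (mxvec_index i j) k.
have sum3 (g : 'I_(n * n * n) -> C) : \sum_p g p = \sum_i \sum_j \sum_k g (t i j k).
  by rewrite sum_mxvec_index sum_mxvec_index.
have sumd (g : 'I_n -> C) i : \sum_j g j * (i == j)%:R = g i.
  rewrite (bigD1 i) //= eqxx mulr1 big1 ?addr0 // => j.
  by rewrite eq_sym => /negPf ->; rewrite mulr0.
have sumd' (g : 'I_n -> C) i : \sum_j g j * (j == i)%:R = g i.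
  by rewrite -[RHS]sumd; apply: eq_bigr => j _; rewrite eq_sym.
have l12 i j k i' j' k' : leg12 V (t i j k) (t i' j' k')
    = V (mxvec_index i j) (mxvec_index i' j') * (k == k')%:R.
  by rewrite mxE /ix1 /ix2 /ix3 /t !unpairK.
have l13 i j k i' j' k' : leg13 V (t i j k) (t i' j' k')
    = V (mxvec_index i k) (mxvec_index i' k') * (j == j')%:R.
  by rewrite mxE /ix1 /ix2 /ix3 /t !unpairK.
have l23 i j k i' j' k' : leg23 V (t i j k) (t i' j' k')
    = V (mxvec_index j k) (mxvec_index j' k') * (i == i')%:R.
  by rewrite mxE /ix1 /ix2 /ix3 /t !unpairK.
rewrite -/(t a b c) -/(t d e f) -mulmxA !mxE !sum3.
have -> : \sum_i \sum_j \sum_k leg23 V (t a b c) (t i j k) * leg12 V (t i j k) (t d e f)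
   = \sum_q V (mxvec_index b c) (mxvec_index q f) * V (mxvec_index a q) (mxvec_index d e).
  under eq_bigr do under eq_bigr do under eq_bigr do rewrite l23 l12 mulrA.
  under eq_bigr do under eq_bigr do rewrite sumd'.
  rewrite exchange_big /=; apply: eq_bigr => j _.
  under eq_bigr do rewrite mulrAC.
  by rewrite sumd.
move=> <-; apply: eq_bigr => p _; apply: eq_bigr => q _.
under [RHS]eq_bigr do rewrite l12 mulrAC.
rewrite sumd mxE sum3.
have -> : \sum_i \sum_j \sum_k leg13 V (t p q c) (t i j k) * leg23 V (t i j k) (t d e f)
   = \sum_r V (mxvec_index p c) (mxvec_index d r) * V (mxvec_index q r) (mxvec_index e f).
  under eq_bigr do under eq_bigr do under eq_bigr do rewrite l13 l23 mulrA.
  under eq_bigr do rewrite exchange_big /=.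
  rewrite exchange_big /=.
  under eq_bigr do under eq_bigr do rewrite -mulr_suml.
  under eq_bigr do rewrite sumd'.
  by apply: eq_bigr => r _; under eq_bigr do rewrite mulrAC; rewrite sumd.
by rewrite mulr_sumr; apply: eq_bigr => r _; rewrite mulrA.
Qed.

Let VW : V *m W = 1%:M. Proof. by case: mV => -[]. Qed.
Let WV : W *m V = 1%:M. Proof. by case: mV => -[]. Qed.

(** The pentagon read as V13 V23 = V12^{-1} V23 V12: products of coefficients are combinations of
    coefficients, so these span an algebra. *)
Lemma coef_mul p d q e :
  v p d *m v q e = \sum_a \sum_b \sum_r
    (W (mxvec_index p q) (mxvec_index a b) * V (mxvec_index a r) (mxvec_index d e)) *: v b r.
Proof.
apply/matrixP => c f.
pose X : 'cV_(n * n) := \col_i (v (unpair i).1 d *m v (unpair i).2 e) c f.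
pose Y : 'cV_(n * n) := \col_i \sum_r
  V (mxvec_index (unpair i).1 r) (mxvec_index d e) * v (unpair i).2 r c f.
have VX : V *m X = Y.
  apply/colP => k; case/mxvec_indexP: k => a b.
  rewrite !mxE !unpairK sum_mxvec_index /=.
  transitivity (\sum_r V (mxvec_index b c) (mxvec_index r f) * V (mxvec_index a r) (mxvec_index d e)).
    rewrite -pentagon_coef; apply: eq_bigr => i _; apply: eq_bigr => j _.
    rewrite mxE unpairK mxE mulr_sumr; apply: eq_bigr => k _.
    by rewrite !mxE mulrA.
  by apply: eq_bigr => r _; rewrite !mxE mulrC.
transitivity ((W *m Y) (mxvec_index p q) 0).
  by rewrite -VX mulmxA WV mul1mx [RHS]mxE unpairK.
rewrite mxE sum_mxvec_index summxE; apply: eq_bigr => a _.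
rewrite summxE; apply: eq_bigr => b _; rewrite [Y _ _]mxE unpairK mulr_sumr summxE.
by apply: eq_bigr => r _; rewrite [RHS]mxE mulrA.
Qed.

Lemma coprod_mul x y : coprod V (x *m y) = coprod V x *m coprod V y.
Proof.
rewrite /coprod -tensop_mulr1 -/W !mulmxA; congr (_ *m _).
by rewrite -[_ *m W *m V]mulmxA WV mulmx1.
Qed.

(** The pentagon read as V23 V12 V23^{-1} = V12 V13, at the entry [(i, k)] of the first leg. *)
Lemma coprod_coef i k : coprod V (v i k) = \sum_m tensop (v i m) (v m k).
Proof.
suff E : V *m tensop (v i k) 1%:M = (\sum_m tensop (v i m) (v m k)) *m V.
  by rewrite /coprod E -mulmxA -/W VW mulmx1.
apply/matrixP => p q.
case/mxvec_indexP: p => b c; case/mxvec_indexP: q => e f.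
have := pentagon_coef i b c k e f.
move=> E; rewrite mxE sum_mxvec_index [RHS]mxE sum_mxvec_index.
transitivity (\sum_r V (mxvec_index b c) (mxvec_index r f) * V (mxvec_index i r) (mxvec_index k e)).
  apply: eq_bigr => r _; rewrite (bigD1 f) //= big1 ?addr0 => [|g /negPf ng].
    by rewrite !mxE !unpairK /= eqxx mulr1.
  by rewrite !mxE !unpairK /= ng !mulr0.
rewrite -E.
under [RHS]eq_bigr do under eq_bigr do rewrite summxE mulr_suml.
under [RHS]eq_bigr do rewrite exchange_big /=.
rewrite [RHS]exchange_big /=; apply: eq_bigr => j _; apply: eq_bigr => r _.
by apply: eq_bigr => t _; rewrite !mxE !unpairK.
Qed.

(** Slicing the second leg of the coproduct leaves the first factor, so [coact2] preserves right
    coideals; [coact1] likewise preserves left ones. *)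
Definition coact2 j l x := slice2 (coprod V x) j l.
Definition coact1 i k x := slice1 (coprod V x) i k.

Lemma coprod_lin : lin (coprod V).
Proof.
by move=> c x y; rewrite /coprod tensop_lin mulmxDr mulmxDl -scalemxAr -scalemxAl.
Qed.

Lemma coact2_lin j l : lin (coact2 j l).
Proof. by move=> c x y; rewrite /coact2 coprod_lin slice2_lin. Qed.

Lemma coact1_lin i k : lin (coact1 i k).
Proof. by move=> c x y; rewrite /coact1 coprod_lin slice1_lin. Qed.

Lemma slice1_sum I (r : seq I) (X : I -> 'M[C]_(n * n)) i k :
  slice1 (\sum_(t <- r) X t) i k = \sum_(t <- r) slice1 (X t) i k.
Proof.
have := lin_sum r (fun=> 1) X (@slice1_lin C n i k).
by under eq_bigr do rewrite scale1r; under [in X in _ = X -> _]eq_bigr do rewrite scale1r.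
Qed.

Lemma slice2_sum I (r : seq I) (X : I -> 'M[C]_(n * n)) i k :
  slice2 (\sum_(t <- r) X t) i k = \sum_(t <- r) slice2 (X t) i k.
Proof.
have := lin_sum r (fun=> 1) X (@slice2_lin C n i k).
by under eq_bigr do rewrite scale1r; under [in X in _ = X -> _]eq_bigr do rewrite scale1r.
Qed.

(** [coact2 j l] acts on the column index of [v] by the matrix [u j l], and [coact1 j l] on the row
    index by the same matrix; identities between the [u j l] thus become identities between
    coactions. *)
Lemma coact2_coef j l i k : coact2 j l (v i k) = \sum_m u j l m k *: v i m.
Proof.
rewrite /coact2 coprod_coef slice2_sum; apply: eq_bigr => m _.
by rewrite slice2_tensop !mxE.
Qed.

Lemma coact1_coef j l i k : coact1 j l (v i k) = \sum_m u j l i m *: v m k.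
Proof.
rewrite /coact1 coprod_coef slice1_sum; apply: eq_bigr => m _.
by rewrite slice1_tensop !mxE.
Qed.

Lemma coact2_mul j l x y :
  coact2 j l (x *m y) = \sum_m coact2 j m x *m coact2 m l y.
Proof. by rewrite /coact2 coprod_mul slice2_mul. Qed.

Lemma coact1_mul i k x y :
  coact1 i k (x *m y) = \sum_m coact1 i m x *m coact1 m k y.
Proof. by rewrite /coact1 coprod_mul slice1_mul. Qed.

End MultiplicativeUnitary.

(** * Spans of families of matrices *)

Section Span.
Variables (F : numFieldType) (n : nat) (u : 'I_n -> 'I_n -> 'M[F]_n).

Definition mxspan (X : 'M[F]_n) := exists c : 'M_n, X = \sum_p \sum_q c p q *: u p q.

Lemma mxspan_lin c X Y : mxspan X -> mxspan Y -> mxspan (c *: X + Y).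
Proof.
move=> [w ->] [w' ->]; exists (c *: w + w').
rewrite scaler_sumr -big_split; apply: eq_bigr => i _ /=.
rewrite scaler_sumr -big_split; apply: eq_bigr => k _ /=.
by rewrite !mxE scalerDl scalerA.
Qed.

Lemma mxspan0 : mxspan 0.
Proof.
by exists 0; rewrite big1 // => p _; rewrite big1 // => q _; rewrite mxE scale0r.
Qed.

Lemma mxspanZ c X : mxspan X -> mxspan (c *: X).
Proof. by move=> uX; rewrite -[_ *: _]addr0; apply: mxspan_lin mxspan0. Qed.

Lemma mxspan_coef p q : mxspan (u p q).
Proof.
exists (delta_mx p q); rewrite (bigD1 p) //= [X in _ + X]big1 ?addr0.
  rewrite (bigD1 q) //= big1 ?addr0; first by rewrite mxE !eqxx scale1r.
  by move=> l /negPf nl; rewrite mxE nl andbF scale0r.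
by move=> j /negPf nj; rewrite big1 // => l _; rewrite mxE nj scale0r.
Qed.

Lemma mxspan_sum I (r : seq I) (X : I -> 'M[F]_n) :
  (forall i, mxspan (X i)) -> mxspan (\sum_(i <- r) X i).
Proof.
move=> uX; elim/big_rec: _ => [|i y _ uy]; first exact: mxspan0.
by rewrite -[X i]scale1r; apply: mxspan_lin.
Qed.

Lemma mxspan_mul X Y : (forall p q r s, mxspan (u p q *m u r s)) ->
  mxspan X -> mxspan Y -> mxspan (X *m Y).
Proof.
move=> uu [w ->] [w' ->]; rewrite mulmx_suml; apply: mxspan_sum => p.
rewrite mulmx_suml; apply: mxspan_sum => q; rewrite mulmx_sumr.
apply: mxspan_sum => r; rewrite mulmx_sumr; apply: mxspan_sum => s.
by rewrite -scalemxAr -scalemxAl; do 2!apply: mxspanZ; apply: uu.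
Qed.

Lemma mxspan_ext (M : lmodType F) (f g : 'M[F]_n -> M) x :
  lin f -> lin g -> (forall i k, f (u i k) = g (u i k)) -> mxspan x -> f x = g x.
Proof.
move=> fL gL fg [w ->].
have E : \sum_i \sum_k w i k *: u i k = \sum_i 1 *: \sum_k w i k *: u i k.
  by apply: eq_bigr => i _; rewrite scale1r.
rewrite E !lin_sum //; apply: eq_bigr => i _; congr (_ *: _).
by rewrite !lin_sum //; apply: eq_bigr => k _; rewrite fg.
Qed.

Lemma mxspan_stable (f : 'M[F]_n -> 'M[F]_n) x :
  lin f -> (forall i k, mxspan (f (u i k))) -> mxspan x -> mxspan (f x).
Proof.
move=> fL fu [w ->].
have -> : \sum_i \sum_k w i k *: u i k = \sum_i 1 *: \sum_k w i k *: u i k.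
  by apply: eq_bigr => i _; rewrite scale1r.
rewrite lin_sum //; apply: mxspan_sum => i; apply: mxspanZ; rewrite lin_sum //.
by apply: mxspan_sum => k; apply: mxspanZ.
Qed.

End Span.

(** * Invariance of the trace, inverse coactions and the counit *)

Section CoidealSubalgebras.
Variables (C : numClosedFieldType) (n : nat) (V : 'M[C]_(n * n)).
Hypothesis mV : multiplicative_unitary V.
Hypothesis n0 : (0 < n)%N.
Hypothesis S1 : Salg V 1%:M.

Let W := adjmx V.
Let v := slice1 V.
Let u := slice2 V.
Let VW : V *m W = 1%:M. Proof. by case: mV => -[]. Qed.
Let WV : W *m V = 1%:M. Proof. by case: mV => -[]. Qed.

Lemma Salg_span x : Salg V x <-> mxspan v x.
Proof.
have E w : slice V w = \sum_i \sum_k w i k *: v i k.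
  apply/matrixP => j l; rewrite mxE summxE; apply: eq_bigr => i _.
  by rewrite summxE; apply: eq_bigr => k _; rewrite !mxE.
by split=> -[w ->]; exists w; rewrite E.
Qed.

Lemma Salg_subalg : subalg (Salg V).
Proof.
split=> [//|c x y|x y]; rewrite !Salg_span; first exact: mxspan_lin.
apply: mxspan_mul => p d q e; rewrite (coef_mul mV).
do 3!apply: mxspan_sum => ?; apply: mxspanZ; exact: mxspan_coef.
Qed.

(** Dual to [coef_mul]: the entries of [u b q *m u c r] are entries of the coproducts of the
    [v i k], expanded from the definition of [coprod]. *)
Lemma slice2_coef_mul b q c r : u b q *m u c r =
  \sum_s \sum_t \sum_s' (V (mxvec_index b c) (mxvec_index s t)
                         * W (mxvec_index s' t) (mxvec_index q r)) *: u s s'.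
Proof.
apply/matrixP => i k.
transitivity (coprod V (v i k) (mxvec_index b c) (mxvec_index q r)).
  rewrite (coprod_coef mV) summxE mxE; apply: eq_bigr => m _.
  by rewrite !mxE !unpairK.
rewrite /coprod -mulmxA mxE sum_mxvec_index summxE; apply: eq_bigr => s _.
rewrite summxE; apply: eq_bigr => t _; rewrite mxE sum_mxvec_index summxE mulr_sumr.
apply: eq_bigr => s' _; rewrite (bigD1 t) //= big1 ?addr0 => [|t' /negPf nt].
  rewrite [tensop _ _ _ _]mxE !unpairK /= [1%:M _ _]mxE eqxx mulr1 [RHS]mxE.
  by rewrite [v _ _ _ _]mxE [u _ _ _ _]mxE; ring.
by rewrite [tensop _ _ _ _]mxE !unpairK /= [1%:M _ _]mxE eq_sym nt mulr0 mul0r.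
Qed.

(* [adjmx V], being a polynomial in [V], has all its slices in the span of
   those of [V]. *)
Lemma mxspan_slice2_adj :
  mxspan u 1%:M /\ forall j l, mxspan u (slice2 W j l).
Proof.
pose E X := forall j l, mxspan u (slice2 X j l).
have uV : V \in unitmx by case: (mulmx1_unit VW).
have E0 : E 0.
  move=> j l; rewrite (_ : slice2 _ _ _ = 0); first exact: mxspan0.
  by apply/matrixP => i k; rewrite !mxE.
have EW : E 1%:M /\ E W.
  have -> : W = invmx V by apply: (can_inj (mulKmx uV)); rewrite VW mulmxV.
  apply: invmx_closed uV _ => [//|X Y EX EY j l|c X EX j l|X Y EX EY j l|j l].
  - by rewrite -[X]scale1r slice2_lin; apply: mxspan_lin.
  - by rewrite -[_ *: _]addr0 slice2_lin; apply: mxspan_lin (EX _ _) (E0 _ _).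
  - rewrite slice2_mul; apply: mxspan_sum => m; apply: mxspan_mul => // b q c r.
    rewrite slice2_coef_mul; do 3!apply: mxspan_sum => ?; apply: mxspanZ; exact: mxspan_coef.
  exact: mxspan_coef.
case: EW => E1 EW; split=> //.
by have := E1 (Ordinal n0) (Ordinal n0); rewrite slice2_1 eqxx.
Qed.

Let T := \matrix_(i, k) \tr (v i k).

(** The trace of [coprod V (v i k)] is computed twice: through [coprod_coef], and through invariance
    of the trace under conjugation by [V]. *)
Lemma trace_mx_sqr : T *m T = n%:R *: T.
Proof.
apply/matrixP => i k; rewrite !mxE.
transitivity (\tr (coprod V (v i k))).
  rewrite (coprod_coef mV) raddf_sum; apply: eq_bigr => m _.
  by rewrite /= mxtrace_tensop !mxE.
rewrite /coprod mxtrace_mulC mulmxA -/W WV mul1mx mxtrace_tensop mxtrace1.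
by rewrite mulrC.
Qed.

(* With [X := V *m tensop T 1 - tensop T 1], unitarity and [T *m T = n *: T] give
   [\tr (adjmx X *m X) = 0]; likewise on the other side. *)
Lemma mul_tensop_trace_mx :
  V *m tensop T 1%:M = tensop T 1%:M /\ tensop T 1%:M *m V = tensop T 1%:M.
Proof.
set P := tensop T 1%:M.
have trVP A : \tr (V *m tensop A 1%:M) = \tr (T *m A) by rewrite mxtrace_mul_tensop1.
have aP : adjmx P = tensop (adjmx T) 1%:M by rewrite adjmx_tensop1.
(* Cyclicity moves [P *m adjmx P] next to [V]; the partial trace of [V] is [T], and [T *m T] absorbs
   the factor [n]. *)
have tr1 : \tr (adjmx P *m V *m P) = \tr (adjmx P *m P).
  rewrite -mulmxA mxtrace_mulC -mulmxA aP tensop_mulr1 trVP mulmxA trace_mx_sqr.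
  rewrite -scalemxAl mxtraceZ mxtrace_mulC.
  by rewrite tensop_mulr1 mxtrace_tensop mxtrace1 mulrC.
have tr2 : \tr (P *m V *m adjmx P) = \tr (P *m adjmx P).
  rewrite mxtrace_mulC mulmxA mxtrace_mulC aP tensop_mulr1 trVP mxtrace_mulC -mulmxA.
  rewrite trace_mx_sqr -scalemxAr mxtraceZ tensop_mulr1 mxtrace_tensop mxtrace1.
  by rewrite mulrC mxtrace_mulC.
split; apply/eqP; rewrite -subr_eq0; apply/eqP.
  apply: mxtrace_adj_mul_eq0; rewrite adjmxB adjmx_mul -/W mulmxBl !mulmxBr.
  rewrite !mulmxA -[_ *m W *m V]mulmxA WV mulmx1 !raddfB /= tr1.
  rewrite -(_ : (\tr (adjmx P *m V *m P))^* = \tr (adjmx P *m W *m P)).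
    rewrite tr1 -mxtrace_adj adjmx_mul adjmxK; ring.
  by rewrite -mxtrace_adj !adjmx_mul adjmxK mulmxA.
suff X0 : adjmx (P *m V - P) = 0.
  by rewrite -[LHS]adjmxK X0; apply/matrixP => i j; rewrite !mxE conjC0.
apply: mxtrace_adj_mul_eq0; rewrite adjmxK adjmxB adjmx_mul -/W mulmxBl !mulmxBr.
rewrite !mulmxA -[_ *m V *m W]mulmxA VW mulmx1 !raddfB /= tr2.
rewrite -(_ : (\tr (P *m V *m adjmx P))^* = \tr (P *m W *m adjmx P)).
  rewrite tr2 -mxtrace_adj adjmx_mul adjmxK; ring.
by rewrite -mxtrace_adj !adjmx_mul adjmxK mulmxA.
Qed.

(** Slices of the two identities for [tensop T 1%:M]. They say that applying the trace to either leg
    of the coproduct of [v i k] gives the scalar [\tr (v i k)]. *)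
Lemma trace_invariant i k :
  \sum_m \tr (v m k) *: v i m = (\tr (v i k))%:M /\
  \sum_m \tr (v i m) *: v m k = (\tr (v i k))%:M.
Proof.
have [VT TV] := mul_tensop_trace_mx; split.
  have := congr1 (fun X => slice1 X i k) VT; rewrite /= slice1_mul slice1_tensop.
  rewrite mxE scalemx1 => <-; apply: eq_bigr => m _.
  by rewrite slice1_tensop mxE -scalemxAr mulmx1.
have := congr1 (fun X => slice1 X i k) TV; rewrite /= slice1_mul slice1_tensop.
rewrite mxE scalemx1 => <-; apply: eq_bigr => m _.
by rewrite slice1_tensop mxE -scalemxAl mul1mx.
Qed.

Lemma sum_scalar_col (A : 'I_n -> 'M[C]_n) a i k : \sum_m A m = a%:M ->
  \sum_m \sum_d A m d k *: v i d = a *: v i k.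
Proof.
move=> EA; rewrite exchange_big /=.
transitivity (\sum_d (a%:M : 'M_n) d k *: v i d).
  by apply: eq_bigr => d _; rewrite -EA summxE scaler_suml.
rewrite (bigD1 k) //= big1 ?addr0; first by rewrite mxE eqxx.
by move=> d /negPf nd; rewrite mxE nd scale0r.
Qed.

Lemma sum_scalar_row (A : 'I_n -> 'M[C]_n) a i k : \sum_m A m = a%:M ->
  \sum_m \sum_d A m i d *: v d k = a *: v i k.
Proof.
move=> EA; rewrite exchange_big /=.
transitivity (\sum_d (a%:M : 'M_n) i d *: v d k).
  by apply: eq_bigr => d _; rewrite -EA summxE scaler_suml.
rewrite (bigD1 i) //= big1 ?addr0; first by rewrite mxE eqxx.
by move=> d /negPf nd; rewrite mxE eq_sym nd scale0r.
Qed.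

Lemma comp_col (f g : 'M[C]_n -> 'M[C]_n) (X Y : 'M[C]_n) i k : lin f ->
  (forall i k, f (v i k) = \sum_m X m k *: v i m) ->
  (forall i k, g (v i k) = \sum_m Y m k *: v i m) ->
  f (g (v i k)) = \sum_m (X *m Y) m k *: v i m.
Proof.
move=> fL fv gv; rewrite gv (lin_sum _ _ _ fL).
under eq_bigr do rewrite fv scaler_sumr.
rewrite exchange_big /=; apply: eq_bigr => d _; rewrite mxE scaler_suml.
by apply: eq_bigr => m _; rewrite scalerA mulrC.
Qed.

(** Operators on the row index compose in the reverse order, which is why the indices for [coact1]
    are swapped in [inverse_coactions]. *)
Lemma comp_row (f g : 'M[C]_n -> 'M[C]_n) (X Y : 'M[C]_n) i k : lin f ->
  (forall i k, f (v i k) = \sum_m X i m *: v m k) ->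
  (forall i k, g (v i k) = \sum_m Y i m *: v m k) ->
  f (g (v i k)) = \sum_m (Y *m X) i m *: v m k.
Proof.
move=> fL fv gv; rewrite gv (lin_sum _ _ _ fL).
under eq_bigr do rewrite fv scaler_sumr.
rewrite exchange_big /=; apply: eq_bigr => d _; rewrite mxE scaler_suml.
by apply: eq_bigr => m _; rewrite scalerA.
Qed.

(** Slices of [W] give the inverse coactions. Being combinations of the [u p q], they turn into
    combinations of [coact2] or [coact1], which preserve whatever subalgebra these preserve. *)
Lemma inverse_coactions : exists (D' C' : 'I_n -> 'I_n -> 'M[C]_n -> 'M[C]_n),
  [/\ (forall j l, lin (D' j l)) /\ (forall j l, lin (C' j l)),
      (forall (B : 'M[C]_n -> Prop), subalg B ->
        (forall j l x, B x -> B (coact2 V j l x)) -> forall j l x, B x -> B (D' j l x)) /\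
      (forall (B : 'M[C]_n -> Prop), subalg B ->
        (forall j l x, B x -> B (coact1 V j l x)) -> forall j l x, B x -> B (C' j l x)),
      forall x j l, Salg V x -> \sum_m coact2 V j m (D' m l x) = (j == l)%:R *: x /\
        \sum_m D' j m (coact2 V m l x) = (j == l)%:R *: x
    & forall x j l, Salg V x -> \sum_m coact1 V m j (C' l m x) = (j == l)%:R *: x /\
        \sum_m C' m j (coact1 V l m x) = (j == l)%:R *: x].
Proof.
have [_ uW] := mxspan_slice2_adj.
have /fin_all_exists[cf cfE] : forall j, exists c : 'I_n -> 'M_n,
    forall l, slice2 W j l = \sum_p \sum_q c l p q *: u p q.
  by move=> j; apply: fin_all_exists (uW j).
pose comb (D : 'I_n -> 'I_n -> 'M[C]_n -> 'M[C]_n) j l x :=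
  \sum_p \sum_q cf j l p q *: D p q x.
have lin_sumf (f : 'I_n -> 'M[C]_n -> 'M[C]_n) : (forall m, lin (f m)) ->
    lin (fun x => \sum_m f m x).
  move=> fL c x y; rewrite scaler_sumr -big_split; apply: eq_bigr => m _ /=.
  exact: fL.
have linZ a (f : 'M[C]_n -> 'M[C]_n) : lin f -> lin (fun x => a *: f x).
  by move=> fL c x y; rewrite fL scalerDr !scalerA mulrC.
have comb_lin D : (forall p q, lin (D p q)) -> forall j l, lin (comb D j l).
  by move=> DL j l; apply: (lin_sumf) => p; apply: (lin_sumf) => q; apply: linZ.
have comb_closed D (B : 'M[C]_n -> Prop) : subalg B ->
    (forall j l x, B x -> B (D j l x)) -> forall j l x, B x -> B (comb D j l x).
  move=> sB DB j l x Bx; have -> : comb D j l x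
      = \sum_p 1 *: \sum_q cf j l p q *: D p q x.
    by apply: eq_bigr => p _; rewrite scale1r.
  by apply: subalg_sum => // p; apply: subalg_sum => // q; apply: DB.
have d2L := coact2_lin V; have d1L := coact1_lin V.
have D2v j l i k : comb (coact2 V) j l (v i k) = \sum_m slice2 W j l m k *: v i m.
  rewrite /comb cfE.
  under eq_bigr do under eq_bigr do rewrite (coact2_coef mV) scaler_sumr.
  under eq_bigr do rewrite exchange_big /=.
  rewrite exchange_big /=; apply: eq_bigr => m _.
  rewrite summxE scaler_suml; apply: eq_bigr => p _.
  rewrite summxE scaler_suml; apply: eq_bigr => q _.
  by rewrite [in RHS]mxE scalerA.
have D1v j l i k : comb (coact1 V) j l (v i k) = \sum_m slice2 W j l i m *: v m k.
  rewrite /comb cfE.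
  under eq_bigr do under eq_bigr do rewrite (coact1_coef mV) scaler_sumr.
  under eq_bigr do rewrite exchange_big /=.
  rewrite exchange_big /=; apply: eq_bigr => m _.
  rewrite summxE scaler_suml; apply: eq_bigr => p _.
  rewrite summxE scaler_suml; apply: eq_bigr => q _.
  by rewrite [in RHS]mxE scalerA.
have WuE j l : \sum_m slice2 W j m *m u m l = (j == l)%:R%:M.
  by rewrite -slice2_mul WV slice2_1.
have uWE j l : \sum_m u j m *m slice2 W m l = (j == l)%:R%:M.
  by rewrite -slice2_mul VW slice2_1.
have lin_id a : lin (fun x : 'M[C]_n => a *: x) by apply: (linZ a id).
have lin_comp (f g : 'M[C]_n -> 'M[C]_n) : lin f -> lin g -> lin (fun x => f (g x)).
  by move=> fL gL c x y; rewrite gL fL.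
exists (comb (coact2 V)), (comb (coact1 V)); split.
- by split; apply: comb_lin.
- by split=> B sB cB; apply: comb_closed.
- move=> x j l /Salg_span Sx; split.
    apply: (mxspan_ext (f := fun x => \sum_m coact2 V j m (comb (coact2 V) m l x))
      _ (lin_id _) _ Sx).
      by apply: (lin_sumf) => m; apply: lin_comp => //; apply: comb_lin.
    move=> i k; rewrite -(sum_scalar_col i k (uWE j l)); apply: eq_bigr => m _.
    exact: (comp_col i k (d2L j m) (coact2_coef mV j m) (D2v m l)).
  apply: (mxspan_ext (f := fun x => \sum_m comb (coact2 V) j m (coact2 V m l x))
    _ (lin_id _) _ Sx).
    by apply: (lin_sumf) => m; apply: lin_comp => //; apply: comb_lin.
  move=> i k; rewrite -(sum_scalar_col i k (WuE j l)); apply: eq_bigr => m _.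
  exact: (comp_col i k (comb_lin _ d2L j m) (D2v j m) (coact2_coef mV m l)).
move=> x j l /Salg_span Sx; split.
  apply: (mxspan_ext (f := fun x => \sum_m coact1 V m j (comb (coact1 V) l m x))
    _ (lin_id _) _ Sx).
    by apply: (lin_sumf) => m; apply: lin_comp => //; apply: comb_lin.
  move=> i k; rewrite eq_sym -(sum_scalar_row i k (WuE l j)); apply: eq_bigr => m _.
  exact: (comp_row i k (d1L m j) (coact1_coef mV m j) (D1v l m)).
apply: (mxspan_ext (f := fun x => \sum_m comb (coact1 V) m j (coact1 V l m x))
  _ (lin_id _) _ Sx).
  by apply: (lin_sumf) => m; apply: lin_comp => //; apply: comb_lin.
move=> i k; rewrite eq_sym -(sum_scalar_row i k (uWE l j)); apply: eq_bigr => m _.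
exact: (comp_row i k (comb_lin _ d1L m j) (D1v m j) (coact1_coef mV l m)).
Qed.

(** The coefficients writing the identity as a combination of the [u p q] define a functional with
    [eps (v i k) = (i == k)%:R], which is the counit. *)
Lemma counit_exists : exists eps : 'M[C]_n -> C,
  [/\ character_on (Salg V) eps,
      forall x, Salg V x -> x = \matrix_(j, l) eps (coact2 V j l x)
    & forall x, Salg V x -> x = \matrix_(j, l) eps (coact1 V j l x)].
Proof.
have [[kap kapE] _] := mxspan_slice2_adj.
pose eps (x : 'M[C]_n) : C := \sum_p \sum_q kap p q * x p q.
have eL : lin (eps : 'M[C]_n -> C^o).
  move=> c x y; rewrite /eps scaler_sumr -big_split; apply: eq_bigr => p _ /=.
  rewrite scaler_sumr -big_split; apply: eq_bigr => q _ /=.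
  by rewrite !mxE mulrDr /GRing.scale /= mulrCA.
have ev i k : eps (v i k) = (i == k)%:R.
  have /matrixP/(_ i k) := kapE; rewrite mxE => ->; rewrite summxE.
  by apply: eq_bigr => p _; rewrite summxE; apply: eq_bigr => q _; rewrite !mxE.
have eM x y : Salg V x -> Salg V y -> eps (x *m y) = eps x * eps y.
  move=> /Salg_span Sx /Salg_span Sy.
  apply: (mxspan_ext (f := fun x => eps (x *m y) : C^o) (g := fun x => eps x * eps y : C^o) _ _ _ Sx).
  - by move=> c a b; rewrite mulmxDl -scalemxAl eL.
  - by move=> c a b; rewrite eL mulrDl /GRing.scale /= mulrA.
  move=> p d.
  apply: (mxspan_ext (f := fun y => eps (v p d *m y) : C^o) (g := fun y => eps (v p d) * eps y : C^o) _ _ _ Sy).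
  - by move=> c a b; rewrite mulmxDr -scalemxAr eL.
  - by move=> c a b; rewrite eL mulrDr /GRing.scale /= mulrCA.
  move=> q e; rewrite !ev (coef_mul mV).
  (* By [coef_mul], the value of [eps] on a product of coefficients is an entry of [W *m V], the
     identity. *)
  transitivity (\sum_a \sum_b W (mxvec_index p q) (mxvec_index a b) * V (mxvec_index a b) (mxvec_index d e)).
    have esum (f : 'I_n -> 'M[C]_n) : eps (\sum_a f a) = \sum_a eps (f a).
      have := lin_sum (index_enum 'I_n) (fun=> 1) f eL.
      under eq_bigr do rewrite scale1r.
      by under [in X in _ = X -> _]eq_bigr do rewrite scale1r.
    rewrite esum; apply: eq_bigr => a _; rewrite esum; apply: eq_bigr => b _.
    rewrite (lin_sum _ _ _ eL) (bigD1 b) //= big1 ?addr0 => [|r /negPf nr].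
      by rewrite ev eqxx /GRing.scale /= mulr1.
    by rewrite ev eq_sym nr scaler0.
  transitivity ((W *m V) (mxvec_index p q) (mxvec_index d e)).
    by rewrite mxE sum_mxvec_index.
  by rewrite WV -tensop11 !mxE !unpairK.
exists eps; split.
- split=> //; have S0 := Salg_span (v (Ordinal n0) (Ordinal n0)).
  have := eM 1%:M _ S1 (proj2 S0 (mxspan_coef v _ _)).
  by rewrite mul1mx !ev eqxx mulr1.
- move=> x /Salg_span Sx.
  apply: (mxspan_ext (f := id) (g := fun x => \matrix_(j, l) eps (coact2 V j l x)) _ _ _ Sx) => //.
    by move=> c a b; apply/matrixP => j l; rewrite !mxE coact2_lin eL.
  move=> i k; apply/matrixP => j l; rewrite [RHS]mxE (coact2_coef mV) (lin_sum _ _ _ eL).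
  rewrite (bigD1 i) //= big1 ?addr0 => [|r /negPf nr].
    by rewrite ev eqxx /GRing.scale /= mulr1 !mxE.
  by rewrite ev eq_sym nr scaler0.
move=> x /Salg_span Sx.
apply: (mxspan_ext (f := id) (g := fun x => \matrix_(j, l) eps (coact1 V j l x)) _ _ _ Sx) => //.
  by move=> c a b; apply/matrixP => j l; rewrite !mxE coact1_lin eL.
move=> i k; apply/matrixP => j l; rewrite [RHS]mxE (coact1_coef mV) (lin_sum _ _ _ eL).
rewrite (bigD1 k) //= big1 ?addr0 => [|r /negPf nr].
  by rewrite ev eqxx /GRing.scale /= mulr1 !mxE.
by rewrite ev nr scaler0.
Qed.

End CoidealSubalgebras.

(** * Regular characters of coideal subalgebras *)

Section TraceFrobenius.
Variables (C : numClosedFieldType) (n : nat) (V : 'M[C]_(n * n)).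
Hypothesis mV : multiplicative_unitary V.
Hypothesis n0 : (0 < n)%N.
Hypothesis S1 : Salg V 1%:M.

Let v := slice1 V.

(** The first claim is invariance of the trace applied to the first leg, the second is invariance
    when it is applied to the second leg; for [coact1] the legs are exchanged. *)
Lemma coact2_invariant x : Salg V x ->
  (forall j l, \tr (coact2 V j l x) = (j == l)%:R * \tr x) /\
  \sum_m coact2 V m m x = (\tr x)%:M.
Proof.
move=> /Salg_span Sx; split=> [j l|].
  apply: (mxspan_ext (f := fun x => \tr (coact2 V j l x) : C^o)
    (g := fun x => (j == l)%:R * \tr x : C^o) _ _ _ Sx).
  - by move=> c a b; rewrite coact2_lin mxtraceD mxtraceZ.
  - by move=> c a b; rewrite mxtraceD mxtraceZ mulrDr /GRing.scale /= mulrCA.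
  move=> i k; rewrite (coact2_coef mV) raddf_sum.
  have /matrixP/(_ j l) := proj2 (trace_invariant mV i k).
  rewrite summxE mxE mulr_natl => <-; apply: eq_bigr => m _.
  by rewrite /= mxtraceZ !mxE mulrC.
apply: (mxspan_ext (f := fun x => \sum_m coact2 V m m x)
  (g := fun x => (\tr x)%:M : 'M[C]_n) _ _ _ Sx).
- move=> c a b; rewrite scaler_sumr -big_split; apply: eq_bigr => m _ /=.
  exact: coact2_lin.
- by move=> c a b; rewrite mxtraceD mxtraceZ raddfD /= scale_scalar_mx.
move=> i k; rewrite -(proj1 (trace_invariant mV i k)).
under eq_bigr do rewrite (coact2_coef mV).
rewrite exchange_big /=; apply: eq_bigr => m _; rewrite -scaler_suml; congr (_ *: _).
by apply: eq_bigr => j _; rewrite !mxE.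
Qed.

Lemma coact1_invariant x : Salg V x ->
  (forall j l, \tr (coact1 V j l x) = (j == l)%:R * \tr x) /\
  \sum_m coact1 V m m x = (\tr x)%:M.
Proof.
move=> /Salg_span Sx; split=> [j l|].
  apply: (mxspan_ext (f := fun x => \tr (coact1 V j l x) : C^o)
    (g := fun x => (j == l)%:R * \tr x : C^o) _ _ _ Sx).
  - by move=> c a b; rewrite coact1_lin mxtraceD mxtraceZ.
  - by move=> c a b; rewrite mxtraceD mxtraceZ mulrDr /GRing.scale /= mulrCA.
  move=> i k; rewrite (coact1_coef mV) raddf_sum.
  have /matrixP/(_ j l) := proj1 (trace_invariant mV i k).
  rewrite summxE mxE mulr_natl => <-; apply: eq_bigr => m _.
  by rewrite /= mxtraceZ !mxE mulrC.
apply: (mxspan_ext (f := fun x => \sum_m coact1 V m m x)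
  (g := fun x => (\tr x)%:M : 'M[C]_n) _ _ _ Sx).
- move=> c a b; rewrite scaler_sumr -big_split; apply: eq_bigr => m _ /=.
  exact: coact1_lin.
- by move=> c a b; rewrite mxtraceD mxtraceZ raddfD /= scale_scalar_mx.
move=> i k; rewrite -(proj2 (trace_invariant mV i k)).
under eq_bigr do rewrite (coact1_coef mV).
rewrite exchange_big /=; apply: eq_bigr => m _; rewrite -scaler_suml; congr (_ *: _).
by apply: eq_bigr => j _; rewrite !mxE.
Qed.

Variable B : 'M[C]_n -> Prop.
Hypotheses (sB : subalg B) (BS : forall x, B x -> Salg V x).

Lemma trace_frobenius_right :
  (forall j l x, B x -> B (coact2 V j l x)) -> trace_frobenius B.
Proof.
move=> cB; have [D' [_ [[D'L _] [D'B _] DD' _]]] := inverse_coactions mV n0.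
have [eps [[eL e1 eM] eD _]] := counit_exists mV n0 S1.
have eB : character_on B eps by split=> // x y Bx By; apply: eM; apply: BS.
apply: (coaction_frobenius n0 sB eB (coact2_lin V) D'L cB (D'B _ sB cB)).
- by move=> j l x y _ _; apply: coact2_mul.
- by move=> j l x /BS Sx; case: (DD' x j l Sx).
- by move=> j l x /BS Sx; case: (DD' x j l Sx).
- by move=> j l x /BS Sx; case: (coact2_invariant Sx).
- by move=> x /BS Sx; case: (coact2_invariant Sx).
by move=> x /BS; apply: eD.
Qed.

(* Right multiplications take the place of left ones: the argument of
   [trace_frobenius_right] applies to the transposed algebra. *)
Lemma trace_frobenius_left :
  (forall j l x, B x -> B (coact1 V j l x)) -> trace_frobenius B.
Proof.
move=> cB; have [_ [C' [[_ C'L] [_ C'B] _ CC']]] := inverse_coactions mV n0.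
have [eps [[eL e1 eM] _ eC]] := counit_exists mV n0 S1.
have {}C'B := C'B _ sB cB.
(* The indices are swapped because transposition reverses the products in [coact1_mul]. *)
pose D j l x := (coact1 V l j x^T)^T; pose D' j l x := (C' l j x^T)^T.
suff fBT : trace_frobenius (fun x => B x^T).
  have -> : B = (fun x => B x^T^T) by apply: funext => x; rewrite trmxK.
  exact: trace_frobenius_tr fBT.
have eB : character_on B eps by split=> // x y Bx By; apply: eM; apply: BS.
have DL j l : lin (D j l) by move=> c x y; rewrite /D !linearP coact1_lin linearP.
have D'L j l : lin (D' j l) by move=> c x y; rewrite /D' !linearP C'L linearP.
apply: (coaction_frobenius n0 (subalg_tr sB) (character_on_tr eB) DL D'L).
- by move=> j l x Bx; rewrite trmxK; apply: cB.
- by move=> j l x Bx; rewrite trmxK; apply: C'B.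
- move=> j l x y _ _; rewrite /D trmx_mul (coact1_mul mV) raddf_sum.
  by apply: eq_bigr => m _; rewrite /= trmx_mul.
- move=> j l x /BS Sx; case: (CC' _ j l Sx) => E _.
  rewrite -[RHS]trmxK linearZ /= -E raddf_sum; apply: eq_bigr => m _.
  by rewrite /D /D' trmxK.
- move=> j l x /BS Sx; case: (CC' _ j l Sx) => _ E.
  rewrite -[RHS]trmxK linearZ /= -E raddf_sum; apply: eq_bigr => m _.
  by rewrite /D /D' trmxK.
- move=> j l x /BS Sx; rewrite mxtrace_tr; case: (coact1_invariant Sx) => -> _.
  by rewrite mxtrace_tr eq_sym.
- move=> x /BS Sx; case: (coact1_invariant Sx) => _.
  by rewrite mxtrace_tr => E; rewrite -tr_scalar_mx -E raddf_sum.
move=> x /BS /eC E; rewrite -[LHS]trmxK {1}E; apply/matrixP => j l.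
by rewrite !mxE /D trmxK.
Qed.

End TraceFrobenius.

Lemma in_tensor_slice2 (C : numClosedFieldType) n (P Q : 'M[C]_n -> Prop) X j l :
  subalg P -> in_tensor P Q X -> P (slice2 X j l).
Proof.
move=> sP [m [a [b [Pa [_ ->]]]]]; rewrite slice2_sum.
by under eq_bigr do rewrite slice2_tensop; apply: subalg_sum.
Qed.

Lemma in_tensor_slice1 (C : numClosedFieldType) n (P Q : 'M[C]_n -> Prop) X j l :
  subalg Q -> in_tensor P Q X -> Q (slice1 X j l).
Proof.
move=> sQ [m [a [b [_ [Qb ->]]]]]; rewrite slice1_sum.
by under eq_bigr do rewrite slice1_tensop; apply: subalg_sum.
Qed.

Unset Implicit Arguments.

Theorem theorem4p9 (R : realType) (n : nat) (V : 'M[R[i]]_(n * n))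
  (B : 'M[R[i]]_n -> Prop) :
  multiplicative_unitary V ->
  multiplicity_one V ->
  left_coideal_subalgebra V B \/ right_coideal_subalgebra V B ->
  free_left_module B (Salg V) /\ free_right_module B (Salg V).
Proof.
move=> mV [xi [xi0 _] _] coB.
(* A nonzero fixed vector cannot live in dimension 0. *)
have n0 : (0 < n)%N.
  by case: n xi xi0 {V B mV coB} => // xi /eqP[]; apply/colP => -[].
have subB : subalgebra_of (Salg V) B by case: coB => -[].
have [BS [B1 [_ [BD [BZ BM]]]]] := subB.
have sB : subalg B by split=> // c x y Bx By; apply: BD => //; apply: BZ.
have S1 := BS _ B1; have sS := Salg_subalg mV S1.
(* [S] is a right coideal of itself, since [coact2] maps coefficients to combinations of
   coefficients. *)
have fS : trace_frobenius (Salg V).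
  apply: (trace_frobenius_right mV n0 S1 sS) => // j l x /Salg_span Sx.
  apply/Salg_span; apply: mxspan_stable Sx; first exact: coact2_lin.
  move=> i k; rewrite (coact2_coef mV); apply: mxspan_sum => m.
  by apply: mxspanZ; apply: mxspan_coef.
have fB : trace_frobenius B.
  case: coB => -[_ cB].
    apply: (trace_frobenius_left mV n0 S1 sB BS) => j l x /cB; exact: in_tensor_slice1.
  apply: (trace_frobenius_right mV n0 S1 sB BS) => j l x /cB; exact: in_tensor_slice2.
have [eps [[eL e1 eM] _ _]] := counit_exists mV n0 S1.
have eB : character_on B eps by split=> // x y Bx By; apply: eM; apply: BS.
exact: free_left_right_module n0 sB sS BS eB fB fS.
Qed.
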